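(* Let $1<p<\infty$ and let $\nu:\mathbb{R}^d\setminus\{0\}\to[0,\infty)$ be measurable and symmetric ($\nu(h)=\nu(-h)$) with $\int_{\mathbb{R}^d}(1\wedge|h|^p)\nu(h)\,dh<\infty$. The following assertions are equivalent. (i) $\nu$ is not integrable, i.e. $\nu\notin L^1(\mathbb{R}^d)$. (ii) The embedding $W^p_\nu(\mathbb{R}^d)\hookrightarrow L^p(K)$ is compact for every measurable set $K\subset\mathbb{R}^d$ with $|K|<\infty$. (iii) The embedding $W^p_\nu(\mathbb{R}^d)\hookrightarrow L^p_{\mathrm{loc}}(\mathbb{R}^d)$ is compact. (iv) The embedding $W^p_\nu(\mathbb{R}^d)\hookrightarrow L^p(B(0,1))$ is compact.
   Context: $W^p_\nu(\mathbb{R}^d)=\{u\in L^p(\mathbb{R}^d): \int_{\mathbb{R}^d}\int_{\mathbb{R}^d}|u(x)-u(y)|^p\nu(x-y)\,dy\,dx<\infty\}$ with norm $\|u\|_{W^p_\nu(\mathbb{R}^d)}=\big(\|u\|^p_{L^p(\mathbb{R}^d)}+\int_{\mathbb{R}^d}\int_{\mathbb{R}^d}|u(x)-u(y)|^p\nu(x-y)\,dy\,dx\big)^{1/p}$. The embedding into $L^p(K)$ is the restriction map $u\mapsto u|_K$. An operator $T:X\to L^p_{\mathrm{loc}}(\mathbb{R}^d)$ on a Banach space $X$ is called compact if for every compact $K\subset\mathbb{R}^d$ the operator $u\mapsto (Tu)|_K$, $X\to L^p(K)$, is compact. $B(0,1)$ is the open unit ball. *)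

(* Defs.v *)
From HB Require Import structures.
From mathcomp Require Import all_boot all_order all_algebra.
From mathcomp Require Import all_classical all_reals all_analysis.
From mathcomp Require Import measurable_realfun lebesgue_measure.

Set Implicit Arguments.
Unset Strict Implicit.
Unset Printing Implicit Defensive.
Import Order.TTheory GRing.Theory Num.Theory.
Import numFieldNormedType.Exports.

Local Open Scope classical_set_scope.
Local Open Scope ring_scope.

Notation borel_rV R n := (g_sigma_algebraType (@open 'rV[R]_n)).

Section cons_rV.
Context (R : realType) (n : nat).

Definition cons_rV (x : measurableTypeR R * borel_rV R n) : borel_rV R n.+1 :=
  row_mx (\row_(_ < 1) x.1) (x.2 : 'rV[R]_n).

Definition uncons_rV (v : borel_rV R n.+1) : measurableTypeR R * borel_rV R n :=
  ((v : 'rV[R]_(1 + n)) 0 (lshift n 0), rsubmx (v : 'rV[R]_(1 + n))).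

Lemma uncons_rVK : cancel uncons_rV cons_rV.
Proof.
move=> v; rewrite /cons_rV /uncons_rV /=; apply/rowP => i.
rewrite -[RHS](congr1 (fun w : 'rV[R]_n.+1 => w 0 i)
  (@hsubmxK _ 1 1 n (v : 'rV[R]_n.+1))) !mxE.
by case: fintype.splitP => j _; rewrite !mxE ?ord1.
Qed.

Lemma cons_rVK : cancel cons_rV uncons_rV.
Proof.
move=> [a v]; rewrite /cons_rV /uncons_rV /=; congr pair.
  by rewrite (@row_mxEl _ 1 1 n) mxE.
exact: (@row_mxKr _ 1 1 n).
Qed.

Lemma rV_rat_ball_cover m (U : set 'rV[R]_m) : open U ->
  U = \bigcup_(qk in [set qk : 'rV[rat]_m * nat |
          ball (map_mx ratr qk.1 : 'rV[R]_m) qk.2.+1%:R^-1 `<=` U])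
        ball (map_mx ratr qk.1 : 'rV[R]_m) qk.2.+1%:R^-1.
Proof.
move=> oU; apply/seteqP; split => [x Ux|x [qk /= + ?]]; last exact.
have /nbhs_ballP[e /= e0 beU] : nbhs x U by apply: open_nbhs_nbhs.
have [k ke] : exists k : nat, k.+1%:R^-1 < e / 2 :> R.
  exists (Num.truncn (e / 2)^-1).
  by rewrite -[ltRHS]invrK ltf_pV2 ?posrE ?invr_gt0 ?divr_gt0// truncnS_gt.
have kn : 0 < k.+1%:R^-1 :> R by rewrite invr_gt0.
have qi i : exists q : rat, ball (x 0 i) k.+1%:R^-1 (ratr q : R).
  have [q] := @rat_in_itvoo R (x 0 i) (x 0 i + k.+1%:R^-1) ltac:(by rewrite ltrDl).
  rewrite in_itv/= => /andP[xq qx]; exists q.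
  by rewrite /ball/= ltr_distlC qx andbT (lt_trans _ xq)// ltrBlDr ltrDl.
have [q qP] := choice qi.
have bq : ball (map_mx ratr (\row_i q i) : 'rV[R]_m) k.+1%:R^-1 x.
  split=> // i j; rewrite ord1 !mxE; exact/ball_sym.
exists (\row_i q i, k) => //= y qy; apply: beU.
apply: (@le_ball _ _ _ (k.+1%:R^-1 + k.+1%:R^-1)).
  by rewrite [leRHS]splitr lerD// ltW.
exact: ball_triangle (ball_sym bq) qy.
Qed.

Lemma measurable_cons_rV : measurable_fun setT cons_rV.
Proof.
apply: (@measurability _ _ _ (borel_rV R n.+1) _ _ (@open 'rV[R]_n.+1)) => //.
move=> _ [U oU <-]; rewrite setTI (rV_rat_ball_cover oU) preimage_bigcup.
rewrite bigcup_mkcond; apply: countable_bigcupT_measurable => // -[q k].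
case: ifPn => // _ /=.
have -> : cons_rV @^-1` ball (map_mx ratr q : 'rV[R]_n.+1) k.+1%:R^-1 =
    ball (ratr ((q : 'rV_(1 + n)) 0 (lshift n 0)) : R) k.+1%:R^-1 `*`
    ball (map_mx ratr (rsubmx (q : 'rV_(1 + n))) : 'rV[R]_n) k.+1%:R^-1.
  apply/seteqP; split => -[a v] /=.
    move=> [k0 qv]; split.
      have := qv 0 (lshift n (0 : 'I_1)).
      by rewrite /cons_rV (@row_mxEl _ 1 1 n) !mxE.
    split=> // i j; have := qv 0 (rshift 1 j).
    by rewrite ord1 /cons_rV (@row_mxEr _ 1 1 n) !mxE.
  move=> [qa [k0 qv]]; split=> // i j; rewrite ord1 /cons_rV !mxE.
  case: fintype.splitP => l jl; rewrite ?mxE.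
    rewrite (_ : j = lshift n (0 : 'I_1))//; apply/val_inj; rewrite /= jl.
    by rewrite ord1.
  have := qv 0 l; rewrite !mxE.
  by rewrite (_ : j = rshift 1 l)//; exact/val_inj.
apply: measurableX.
  exact: measurable_ball.
by apply: sub_sigma_algebra; exact: ball_open.
Qed.

Lemma measurable_uncons_rV : measurable_fun setT uncons_rV.
Proof.
apply/measurable_fun_pairP; split => /=.
  apply: (measurability (@RGenOpens.G R)); first exact: RGenOpens.measurableE.
  move=> _ [_ [a [b ->]] <-]; rewrite setTI; apply: sub_sigma_algebra.
  by apply: open_comp (itv_open _ _) => // x _; exact: coord_continuous.
apply: (@measurability _ _ _ (borel_rV R n) _ _ (@open 'rV[R]_n)) => // _ [U oU <-].
rewrite setTI; apply: sub_sigma_algebra; apply: open_comp oU => v _.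
move=> A /nbhs_ballP[e e0 eA]; apply/nbhs_ballP; exists e => // w [_ vw].
by apply: eA; split=> // i j; rewrite !mxE.
Qed.
End cons_rV.

Section cons_measure.
Context (R : realType) (n : nat).
Variable m : {sigma_finite_measure set (borel_rV R n) -> \bar R}.

Definition cons_measure : set (borel_rV R n.+1) -> \bar R :=
  pushforward (@lebesgue_measure R \x m)%E (@cons_rV R n).

Let cons_measure0 : cons_measure set0 = 0%E.
Proof. by rewrite /cons_measure /pushforward preimage_set0 measure0. Qed.

Let cons_measure_ge0 A : (0 <= cons_measure A)%E.
Proof. exact: (measure_ge0 (@lebesgue_measure R \x m)%E). Qed.

Let measurable_cons_preimage A : measurable A -> measurable (@cons_rV R n @^-1` A).
Proof. by move=> mA; rewrite -[X in measurable X]setTI; exact: measurable_cons_rV. Qed.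

Let cons_measure_sigma_additive : semi_sigma_additive cons_measure.
Proof.
move=> F mF tF mUF; rewrite /cons_measure /pushforward preimage_bigcup.
apply: measure_semi_sigma_additive.
- by move=> k; exact: measurable_cons_preimage.
- apply/trivIsetP => /= i j _ _ ij; rewrite -preimage_setI.
  by move/trivIsetP : tF => /(_ _ _ _ _ ij) ->//; rewrite preimage_set0.
- by rewrite -preimage_bigcup; exact: measurable_cons_preimage.
Qed.

HB.instance Definition _ := isMeasure.Build _ _ _ cons_measure
  cons_measure0 cons_measure_ge0 cons_measure_sigma_additive.

Let cons_measure_sigma_finite : sigma_finite setT cons_measure.
Proof.
have /sigma_finiteP[F [TF ndF Foo]] := sigma_finiteT (@lebesgue_measure R).
have /sigma_finiteP[G [TG ndG Goo]] := sigma_finiteT m.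
exists (fun k => @uncons_rV R n @^-1` (F k `*` G k)).
  rewrite -preimage_bigcup (_ : \bigcup_k _ = setT) ?preimage_setT//.
  rewrite -setXTT TF TG; apply/seteqP; split => -[x y].
    by move=> [k _ []/= ? ?]; split; exists k.
  move=> [/= [i _ Fix] [j _ Gjy]]; exists (maxn i j) => //; split.
    by move: x Fix; exact/subsetPset/ndF/leq_maxl.
  by move: y Gjy; exact/subsetPset/ndG/leq_maxr.
move=> k; have [mF Fk] := Foo k; have [mG Gk] := Goo k; split.
  rewrite -[X in measurable X]setTI; apply: measurable_uncons_rV => //.
  exact: measurableX.
rewrite /cons_measure /pushforward -comp_preimage.
rewrite (_ : _ \o _ = id) ?preimage_id; last exact/funext/cons_rVK.
by rewrite product_measure1E// lte_mul_pinfty// ge0_fin_numE.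
Qed.

HB.instance Definition _ := Measure_isSigmaFinite.Build _ _ _ cons_measure
  cons_measure_sigma_finite.

End cons_measure.

(* The n-fold product of the one-dimensional Lebesgue measure, on the Borel
   sets of R^n. *)
Fixpoint lebesgue_borel (R : realType) (n : nat) :
    {sigma_finite_measure set (borel_rV R n) -> \bar R} :=
  match n with
  | 0 => @dirac _ (borel_rV R 0) (0 : 'rV[R]_0) R
  | n'.+1 => cons_measure (lebesgue_borel R n')
  end.

(* R^d with the sigma-algebra of Lebesgue measurable sets, that is, the
   Caratheodory measurable sets of the outer measure induced by the Borel
   measure above; lebesgue_Rd is the (complete) Lebesgue measure. The topology
   and the algebraic structure are those of 'rV[R]_d. *)
Definition Rd (R : realType) (d : nat) : Type :=
  caratheodory_type (lebesgue_borel R d)^*%mu.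

Definition lebesgue_Rd (R : realType) (d : nat) : set (Rd R d) -> \bar R :=
  @completed_measure_extension _ _ _ (lebesgue_borel R d).

HB.instance Definition _ (R : realType) (d : nat) :=
  Measure.on (@lebesgue_Rd R d).

Lemma lebesgue_Rd_sigma_finite (R : realType) (d : nat) :
  sigma_finite setT (@lebesgue_Rd R d).
Proof. exact/completed_measure_extension_sigma_finite/sigma_finiteT. Qed.

HB.instance Definition _ (R : realType) (d : nat) :=
  Measure_isSigmaFinite.Build _ _ _ (@lebesgue_Rd R d)
    (@lebesgue_Rd_sigma_finite R d).

Lemma open_measurable_Rd (R : realType) (d : nat) (U : set (Rd R d)) :
  open (U : set 'rV[R]_d) -> measurable U.
Proof.
move=> oU; apply: sub_caratheodory; apply: sub_sigma_algebra.
exact: sub_sigma_algebra.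
Qed.

Lemma compact_measurable_Rd (R : realType) (d : nat) (K : set (Rd R d)) :
  compact (K : set 'rV[R]_d) -> measurable K.
Proof.
move=> cK; rewrite -[K]setCK; apply: measurableC; apply: open_measurable_Rd.
apply: (@closed_openC 'rV[R]_d); apply: compact_closed cK.
exact: norm_hausdorff.
Qed.

Definition punctured (R : realType) (d : nat) : set (Rd R d) :=
  [set h : 'rV[R]_d | h != 0].

(* The norm of the library on 'rV[R]_d is the sup norm; |x| is Euclidean. *)
Definition enorm (R : realType) (d : nat) (x : 'rV[R]_d) : R :=
  Num.sqrt (\sum_i x 0 i ^+ 2).

Definition eball (R : realType) (d : nat) (r : R) : set (Rd R d) :=
  [set x : 'rV[R]_d | enorm x < r].

Lemma eball_measurable (R : realType) (d : nat) (r : R) :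
  measurable (@eball R d r).
Proof.
apply: open_measurable_Rd.
rewrite (_ : eball _ = (@enorm R d) @^-1` [set z | z < r])//.
apply: open_comp; last exact: open_lt.
move=> x _; apply: continuous_comp; last exact: sqrt_continuous.
have sumc : continuous (fun v : 'rV[R]_d => \sum_i v 0 i ^+ 2).
  apply: (@continuous_big _ _ +%R); first exact: add_continuous.
  move=> i _ v; apply: (@continuous_comp _ _ _ (fun v : 'rV[R]_d => v 0 i) (fun z => z ^+ 2)).
    exact: coord_continuous.
  exact: exprn_continuous.
exact: sumc.
Qed.

(* L^p is the library's space of a.e.-classes, with the metric ||f - g||_p. *)
Section Lspace_metric.
Context (dT : measure_display) (T : measurableType dT) (R : realType).
Variables (mu : {measure set T -> \bar R}) (p : \bar R) (p1 : (1 <= p)%E).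

Definition Lspace_dist (f g : LspaceType mu p1) : \bar R :=
  'N[mu]_p[EFin \o ((f : T -> R) \- (g : T -> R))%R]%E.

Definition Lspace_ball (f : LspaceType mu p1) (e : R) (g : LspaceType mu p1) :=
  (Lspace_dist f g < e%:E)%E.

Let Lspace_ball_center f e : 0 < e -> Lspace_ball f e f.
Proof.
move=> e0; rewrite /Lspace_ball /Lspace_dist.
rewrite (_ : _ \o _ = cst 0%E); last by apply/funext => x /=; rewrite subrr.
by rewrite Lnorm0 ?lte_fin// gt_eqF// (lt_le_trans _ p1).
Qed.

Let Lspace_ball_sym f g e : Lspace_ball f e g -> Lspace_ball g e f.
Proof.
rewrite /Lspace_ball /Lspace_dist -oppe_Lnorm; congr (is_true (_ < _)%E).
by apply: eq_Lnorm => x /=; rewrite -[LHS]/((- (f x - g x : R))%:E) opprB.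
Qed.

Let Lspace_measurable (f : LspaceType mu p1) :
  measurable_fun setT (f : T -> measurableTypeR R).
Proof. exact: measurable_funPT. Qed.

Let Lspace_ball_triangle f g h e1 e2 :
  Lspace_ball f e1 g -> Lspace_ball g e2 h -> Lspace_ball f (e1 + e2) h.
Proof.
rewrite /Lspace_ball /Lspace_dist => fg gh.
rewrite EFinD (le_lt_trans _ (lteD fg gh))//.
have mB (u v : LspaceType mu p1) :
    measurable_fun setT ((u : T -> R) \- (v : T -> R)).
  by apply: measurable_funB; exact: Lspace_measurable.
have /= := eminkowski mu (mB f g) (mB g h) p1.
rewrite (_ : (_ \+ _)%R = (f : T -> R) \- (h : T -> R))//.
by apply/funext => x /=; rewrite addrA subrK.
Qed.

HB.instance Definition _ := gen_eqMixin (LspaceType mu p1).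
HB.instance Definition _ := gen_choiceMixin (LspaceType mu p1).
HB.instance Definition _ := hasNbhs.Build (LspaceType mu p1)
  (nbhs_ (entourage_ Lspace_ball)).
HB.instance Definition _ := @Nbhs_isPseudoMetric.Build R (LspaceType mu p1)
  (entourage_ Lspace_ball) erefl Lspace_ball
  Lspace_ball_center Lspace_ball_sym Lspace_ball_triangle erefl.

End Lspace_metric.

(* L^p(K) is L^p of the restricted measure A |-> mu (A `&` K); the class of u|_K
   in it is the class of u modulo equality a.e. on K. *)
Section Lspace_restriction.
Context (dT : measure_display) (T : measurableType dT) (R : realType).
Variables (mu : {measure set T -> \bar R}) (K : set T) (mK : measurable K).
Variables (p : R) (p1 : (1 <= p%:E)%E).

Definition aeEqMfun_restr (u : {mfun_ mu, T >-> measurableTypeR R}) :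
    {mfun_ mrestr mu mK, T >-> measurableTypeR R} :=
  \pi%qT (repr u : {mfun T >-> measurableTypeR R}).

Lemma aeEqMfun_restrE (u : {mfun_ mu, T >-> measurableTypeR R}) :
  (aeEqMfun_restr u : T -> measurableTypeR R) = u %[ae mrestr mu mK].
Proof.
have /eqP := reprK (aeEqMfun_restr u).
by rewrite {2}/aeEqMfun_restr eqmodE => /asboolP.
Qed.

Let finite_norm_restr (u : LspaceType mu p1) :
  finite_norm (mrestr mu mK) p%:E (aeEqMfun_restr u).
Proof.
have p0 : 0 < p by rewrite (lt_le_trans ltr01)// -lee_fin.
apply: le_lt_trans (@Lebesgue_finite _ _ _ _ _ _ u).
have mN (f : T -> measurableTypeR R) : measurable_fun setT f ->
    measurable_fun setT (fun x => `|(f x : R)%:E| `^ p)%E.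
  move=> mf; apply: (measurableT_comp (measurable_poweR _)).
  by apply: measurableT_comp => //; exact/measurable_EFinP.
have mu' : measurable_fun setT (u : T -> measurableTypeR R).
  exact: measurable_funPT.
have mr : measurable_fun setT (aeEqMfun_restr u : T -> measurableTypeR R).
  exact: measurable_funPT.
rewrite unlock /Lnorm; apply: gt0_ler_poweR.
- by rewrite invr_ge0 ltW.
- by rewrite in_itv/= leey andbT integral_ge0// => x _; exact: poweR_ge0.
- by rewrite in_itv/= leey andbT integral_ge0// => x _; exact: poweR_ge0.
rewrite (@ge0_ae_eq_integral _ _ _ _ _ _
    (fun x => `|(u x : R)%:E| `^ p)%E); last 6 first.
- exact: measurableT.
- exact: mN.
- exact: mN.
- by move=> x _; exact: poweR_ge0.
- by move=> x _; exact: poweR_ge0.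
- by apply: filterS (aeEqMfun_restrE u) => x /= uE _; rewrite uE.
pose muK : {measure set T -> \bar R} := mrestr mu mK.
pose muK' : {measure set T -> \bar R} := mrestr mu (measurableC mK).
rewrite [leRHS](@eq_measure_integral _ _ _ _ (measure_add muK muK')).
  rewrite ge0_integral_measure_add; last 3 first.
  - exact: measurableT.
  - by move=> x _; exact: poweR_ge0.
  - exact: mN.
  by rewrite leeDl// integral_ge0// => x _; exact: poweR_ge0.
move=> A mA _; rewrite -[RHS]/(measure_add muK muK' A) measure_addE.
rewrite /muK /muK' /= /mrestr.
rewrite -measureU; last 3 first.
- exact: measurableI.
- by apply: measurableI => //; exact: measurableC.
- by rewrite setIACA setICr setI0.
by rewrite -setIUr setUv setIT.
Qed.

Definition Lspace_restr (u : LspaceType mu p1) :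
    LspaceType (mrestr mu mK) p1 :=
  HB.pack (aeEqMfun_restr u) (isFinLebesgue.Build _ _ _ (mrestr mu mK) _ p1
    (aeEqMfun_restr u) (finite_norm_restr u)).

End Lspace_restriction.

(* F sends bounded subsets of the normed space (W, normW) to relatively compact
   sets; W is given as a subset of X. *)
Definition compact_operator (X : Type) (W : set X) (R : realType)
    (normW : X -> \bar R) (Y : topologicalType) (F : X -> Y) : Prop :=
  forall M : R, precompact (F @` [set u | W u /\ (normW u <= M%:E)%E]).

Section nonlocal_Sobolev.
Context (R : realType) (d : nat) (p : R) (p1 : (1 <= p%:E)%E).
Variable nu : Rd R d -> R.
Local Notation mu := (@lebesgue_Rd R d).

(* nu represents a function on R^d \ {0}: its value at 0 is irrelevant here
   because the integrand vanishes for x = y. *)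
Definition nonlocal_energy (u : Rd R d -> R) : \bar R :=
  (\int[mu]_x \int[mu]_y (`|u x - u y| `^ p * nu (x - y))%:E)%E.

Definition W_space : set (LspaceType mu p1) :=
  [set u | (nonlocal_energy u < +oo)%E].

Definition W_norm (u : LspaceType mu p1) : \bar R :=
  (('N[mu]_p%:E[EFin \o u] `^ p + nonlocal_energy u) `^ p^-1)%E.

Definition compact_embedding (K : set (Rd R d)) (mK : measurable K) : Prop :=
  compact_operator W_space W_norm (Lspace_restr mK (p1 := p1)).

Definition compact_embedding_loc : Prop :=
  forall (K : set (Rd R d)) (cK : compact (K : set 'rV[R]_d)),
    compact_embedding (compact_measurable_Rd cK).

End nonlocal_Sobolev.

Lemma gt1_ge1e (R : realType) (p : R) : 1 < p -> (1 <= p%:E)%E.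
Proof. by move=> /ltW; rewrite lee_fin. Qed.

(* Main.v *)
From HB Require Import structures.
Require Import Defs.
From mathcomp Require Import all_boot all_order all_algebra.
From mathcomp Require Import all_classical all_reals all_analysis.
From mathcomp Require Import measurable_realfun lebesgue_measure.
From mathcomp Require Import ring lra.

(** Why the four assertions are equivalent.

    From non-integrability to compactness. If nu is not integrable, it
    dominates, away from the origin, Borel simple functions w of finite but
    arbitrarily large integral I ([borel_minorant_large]).  Averaging f around
    x with the weight w (x - y) / I changes it by little: by a Young inequality

      |f x|^p <= (4^p / I) int |f x - f y|^p w (x - y) dy
                 + (2^p / I^p) |int f y w (x - y) dy|^p

    ([average_bound]), and the first term, integrated in x, is at most a
    constant times the energy of f divided by I, hence uniformly small on
    bounded sets of W.  The second term only sees f through the functionals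
    f |-> int f y w (x - y) dy.  The indicator of a measurable set of the product,
    with sections of finite measure, is, up to small sets of x, a function of x with finitely many values in L^1
    ([sections_split_sigma_finite]), because this property is stable under
    complements and countable unions.  Consequently, up to a small set of x in
    K, finitely many of these functionals determine all of them up to a small
    error ([convolution_kernel_split]).  Two functions u and v on which these
    finitely many bounded functionals nearly agree are therefore close in
    L^p(K) ([bounded_scale_split], applied to f = u - v): the image of a bounded
    set is totally bounded.  Together with the completeness of
    L^p ([Lspace_rapidly_complete]) this gives compactness.

    Restricting the set K preserves total boundedness, so the passages to
    compact sets, which have finite measure, and then to the unit ball, which is
    contained in a compact set, are immediate.

    From compactness on the unit ball to non-integrability. If nu is integrable,
    the energy of f is at most C ||f||_p^p ([integrable_energy_le]), so bounded
    subsets of L^p are bounded in W.  Normalized indicators of disjoint annuli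
    inside the unit ball form such a set, and they are at distance at least 1
    from each other in L^p(B(0,1)) ([separated_bumps]).

    A measurability issue runs through the proof: for a Lebesgue measurable nu
    the function (x, y) |-> nu (x - y) need not be measurable for the product
    sigma-algebra.  Hence nu is replaced, from below or from above, by
    Borel functions ([borel_version], [borel_majorant]), and integrals of
    possibly non-measurable functions are only used through their monotonicity
    ([ge0_le_integral_lower]).  For Borel functions the invariance under
    y |-> x - y follows, by induction on the dimension, from the case of the
    line ([lebesgue_borel_refl]). *)

Set Implicit Arguments.
Unset Strict Implicit.
Unset Printing Implicit Defensive.
Import Order.TTheory GRing.Theory Num.Theory.
Import numFieldNormedType.Exports.
Local Open Scope classical_set_scope.
Local Open Scope ring_scope.

(** * Lebesgue measure of R^d: coordinates, reflections, balls *)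

Lemma ge0_integral_measure_preserving d1 d2 (X : measurableType d1)
    (Y : measurableType d2) (R : realType) (m1 : {measure set X -> \bar R})
    (m2 : {measure set Y -> \bar R}) (phi : X -> Y) (f : Y -> \bar R) :
  measurable_fun setT phi ->
  (forall A, measurable A -> m1 (phi @^-1` A) = m2 A) ->
  measurable_fun setT f -> (forall y, 0 <= f y)%E ->
  (\int[m1]_x f (phi x) = \int[m2]_y f y)%E.
Proof.
move=> mphi m12 mf f0.
have := ge0_integral_pushforward mphi m1 measurableT mf.
rewrite preimage_setT => <-//.
by apply: eq_measure_integral => A mA _; exact: m12.
Qed.

Section borel_rV_measurability.
Context (R : realType).

Lemma measurable_coord_rV n (i : 'I_n) :
  measurable_fun setT (fun v : borel_rV R n => (v : 'rV[R]_n) 0 i : measurableTypeR R).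
Proof.
apply: (measurability (@RGenOpens.G R)); first exact: RGenOpens.measurableE.
move=> _ [_ [a [b ->]] <-]; rewrite setTI; apply: sub_sigma_algebra.
by apply: open_comp (itv_open _ _) => // x _; exact: coord_continuous.
Qed.

(** The sigma-algebra is the Borel one, not the product one; the induction on the
    dimension goes through the splitting-off of the first coordinate. *)
Lemma measurable_fun_rV dT (T : measurableType dT) n (f : T -> 'rV[R]_n) :
  (forall i, measurable_fun setT (fun t => f t 0 i : measurableTypeR R)) ->
  measurable_fun setT (f : T -> borel_rV R n).
Proof.
elim: n f => [|n IH] f mf.
  move=> _ A mA; rewrite setTI.
  have f0 t : f t = 0 by apply/rowP => -[].
  have [A0|A0] := pselect (A (0 : 'rV[R]_0)).
    rewrite (_ : _ @^-1` _ = setT); first exact: measurableT.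
    by apply/seteqP; split => // t _; rewrite /= f0.
  rewrite (_ : _ @^-1` _ = set0); first exact: measurable0.
  by apply/seteqP; split => // t; rewrite /= f0.
rewrite (_ : f = cons_rV (n:=n) \o (fun t => (f t 0 0, rsubmx (f t : 'rV[R]_(1 + n))))).
  apply: measurableT_comp; first exact: measurable_cons_rV.
  apply/measurable_fun_pairP; split => /=; first exact: mf.
  apply: IH => i; rewrite (_ : (fun t => _) = (fun t => f t 0 (rshift 1 i))).
    exact: mf.
  by apply/funext => t; rewrite mxE.
apply/funext => t /=; rewrite -[LHS]uncons_rVK /uncons_rV; congr (cons_rV (_, _)).
by congr (f t 0 _); apply/val_inj.
Qed.

Lemma measurable_sub_rV n :
  measurable_fun setT (fun z : borel_rV R n * borel_rV R n =>
    (z.1 : 'rV[R]_n) - z.2 : borel_rV R n).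
Proof.
apply: measurable_fun_rV => i.
rewrite (_ : (fun t => _) = (fun z : borel_rV R n * borel_rV R n =>
  (z.1 : 'rV[R]_n) 0 i - (z.2 : 'rV[R]_n) 0 i)); last by apply/funext => z; rewrite !mxE.
by apply: measurable_funB; apply: (measurableT_comp (measurable_coord_rV i)).
Qed.

Lemma measurable_Rd_borel n : measurable_fun setT (id : Rd R n -> borel_rV R n).
Proof. by move=> _ A mA; rewrite setTI; exact: caratheodory_measurable_mu_ext. Qed.

Lemma measurable_sub_Rd n :
  measurable_fun setT (fun z : Rd R n * Rd R n =>
    (z.1 : 'rV[R]_n) - (z.2 : 'rV[R]_n) : borel_rV R n).
Proof.
apply: (measurableT_comp (@measurable_sub_rV n)
  (g := fun z : Rd R n * Rd R n => (z.1 : borel_rV R n, z.2 : borel_rV R n))).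
apply/measurable_fun_pairP; split => /=.
  exact: (measurableT_comp (@measurable_Rd_borel n) measurable_fst).
exact: (measurableT_comp (@measurable_Rd_borel n) measurable_snd).
Qed.

Lemma lebesgue_RdE n (A : set (borel_rV R n)) : measurable A ->
  lebesgue_Rd A = lebesgue_borel R n A.
Proof. exact: measurable_mu_extE. Qed.

Lemma measurable_fun_Rd n d' (T : measurableType d') (f : borel_rV R n -> T) :
  measurable_fun setT f -> measurable_fun setT (f : Rd R n -> T).
Proof. by move=> mf; exact: (measurableT_comp mf (@measurable_Rd_borel n)). Qed.

Lemma ge0_integral_Rd n (f : borel_rV R n -> \bar R) :
  measurable_fun setT f -> (forall x, 0 <= f x)%E ->
  (\int[@lebesgue_Rd R n]_x f x = \int[lebesgue_borel R n]_x f x)%E.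
Proof.
move=> mf f0.
by apply: (ge0_integral_measure_preserving (@measurable_Rd_borel n)) => // A; exact: lebesgue_RdE.
Qed.

End borel_rV_measurability.

Section reflection_invariance.
Context (R : realType).

Lemma lebesgue_measure_refl (a : R) (A : set (measurableTypeR R)) : measurable A ->
  lebesgue_measure ((fun x : R => a - x) @^-1` A) = lebesgue_measure A.
Proof.
have mr : measurable_fun setT (fun x : measurableTypeR R => a - x : measurableTypeR R).
  exact: measurable_funB.
move=> mA; apply/esym.
pose m' := measure_function_pushforward__canonical__measure_function_Measure
  (@lebesgue_measure R) mr.
apply: (@lebesgue_measure_unique _ m') => // _ [[b c]] _ <-.
rewrite /m' /= /pushforward /= (_ : _ @^-1` _ = `[a - c, a - b[%classic).
  rewrite !lebesgue_measure_itv/= !lte_fin ltrD2l ltrN2; case: ifPn => // _.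
  by rewrite -!EFinD; congr EFin; ring.
by apply/seteqP; split => x /=; rewrite !in_itv/= => /andP[? ?]; apply/andP; split; lra.
Qed.

Lemma cons_rVB n (a b : R) (v w : 'rV[R]_n) :
  (cons_rV (a, v : borel_rV R n) : 'rV[R]_n.+1) - cons_rV (b, w : borel_rV R n) =
  cons_rV (a - b, v - w : borel_rV R n).
Proof.
rewrite /cons_rV/=; apply/rowP => i; rewrite !mxE.
by case: fintype.splitP => j _; rewrite !mxE.
Qed.

Lemma measurable_refl_rV n (x : 'rV[R]_n) :
  measurable_fun setT (fun y : borel_rV R n => x - y : borel_rV R n).
Proof.
apply: (measurableT_comp (@measurable_sub_rV R n)
  (g := fun y : borel_rV R n => (x : borel_rV R n, y))).
apply/measurable_fun_pairP; split => /=; first exact: (measurable_cst (x : borel_rV R n)).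
exact: measurable_id.
Qed.

(** In dimension n + 1 the measure of a set is the integral of the measures of its
    slices.  Reflecting the last n coordinates does not change these by induction,
    and reflecting the first one does not change their integral. *)
Lemma lebesgue_borel_refl n (x : 'rV[R]_n) (A : set (borel_rV R n)) : measurable A ->
  lebesgue_borel R n ((fun y : 'rV[R]_n => x - y) @^-1` A) = lebesgue_borel R n A.
Proof.
elim: n x A => [|n IH] x A mA.
  rewrite (_ : _ @^-1` _ = A)//; apply/seteqP.
  by split=> y /=; rewrite (_ : x - y = y)//; apply/rowP => -[].
rewrite /= /cons_measure /pushforward /product_measure1.
set B := cons_rV (n:=n) @^-1` A; set C := _ @^-1` _.
have mB : measurable B.
  by rewrite -[X in measurable X]setTI; exact: measurable_cons_rV.
have [a0 [v0 xE]] : exists a0 v0, x = cons_rV (a0, v0 : borel_rV R n).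
  by exists (uncons_rV x).1, (uncons_rV x).2; rewrite -[LHS]uncons_rVK; case: uncons_rV.
pose phi := lebesgue_borel R n \o xsection B.
have mphi : measurable_fun setT phi by exact: measurable_fun_xsection.
rewrite (_ : _ \o _ = phi \o (fun a => a0 - a)); last first.
  apply/funext => a /=; rewrite /phi /= -[RHS](IH v0); last exact: measurable_xsection.
  congr (lebesgue_borel R n _); apply/seteqP.
  by split => v /=; rewrite /xsection /= !inE /C /B /= xE cons_rVB.
have mr : measurable_fun setT (fun x : measurableTypeR R => a0 - x : measurableTypeR R).
  exact: measurable_funB.
apply: (ge0_integral_measure_preserving mr) => //.
  by move=> D mD; exact: lebesgue_measure_refl.
Qed.

Lemma ge0_integral_refl n (phi : borel_rV R n -> \bar R) (x : 'rV[R]_n) :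
  measurable_fun setT phi -> (forall z, 0 <= phi z)%E ->
  (\int[@lebesgue_Rd R n]_y phi (x - (y : 'rV[R]_n))%R = \int[@lebesgue_Rd R n]_y phi y)%E.
Proof.
move=> mphi phi0; rewrite !ge0_integral_Rd//; last first.
  exact: (measurableT_comp mphi (measurable_refl_rV x)).
apply: (ge0_integral_measure_preserving (measurable_refl_rV x)) => //.
by move=> D mD; exact: lebesgue_borel_refl.
Qed.

(** A translation is the composite of two reflections. *)
Lemma ge0_integral_translate n (phi : borel_rV R n -> \bar R) (y : 'rV[R]_n) :
  measurable_fun setT phi -> (forall z, 0 <= phi z)%E ->
  (\int[@lebesgue_Rd R n]_x phi ((x : 'rV[R]_n) - y)%R = \int[@lebesgue_Rd R n]_x phi x)%E.
Proof.
move=> mphi phi0.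
have mpsi : measurable_fun setT (fun z : borel_rV R n => phi (0 - (z : 'rV[R]_n))).
  exact: (measurableT_comp mphi (measurable_refl_rV 0)).
rewrite -(ge0_integral_refl 0 mphi phi0) -(ge0_integral_refl y mpsi)//.
by apply: eq_integral => x _; congr phi; rewrite sub0r opprB.
Qed.

End reflection_invariance.

Section balls.
Context (R : realType).

Lemma rV_ballE n (x y : 'rV[R]_n) (r : R) : 0 < r ->
  ball x r y <-> forall i, `|x 0 i - y 0 i| < r.
Proof.
move=> r0; split => [[_ xy] i|xy]; first exact: (xy 0 i).
by split => // i j; rewrite ord1; exact: xy.
Qed.

Lemma measurable_ball_rV n (x : 'rV[R]_n) (r : R) :
  measurable (ball x r : set (borel_rV R n)).
Proof. by apply: sub_sigma_algebra; exact: ball_open. Qed.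

(** The norm is the sup norm, so that a ball is a cube. *)
Lemma lebesgue_borel_ball n (r : R) : 0 < r ->
  lebesgue_borel R n (ball (0 : 'rV[R]_n) r) = ((r *+ 2) ^+ n)%:E.
Proof.
move=> r0; elim: n => [|n IH] /=.
  rewrite diracE expr0 mem_set//; exact: ballxx.
rewrite /cons_measure /pushforward.
rewrite (_ : _ @^-1` _ = (ball (0 : R) r : set (measurableTypeR R)) `*`
    (ball (0 : 'rV[R]_n) r : set (borel_rV R n))); last first.
  apply/seteqP; split => -[a v] /=.
    move=> /(rV_ballE _ _ r0) av; split.
      by have := av (lshift n (0 : 'I_1)); rewrite /cons_rV (@row_mxEl _ 1 1 n) !mxE.
    apply/rV_ballE => // i; have := av (rshift 1 i).
    by rewrite /cons_rV (@row_mxEr _ 1 1 n) !mxE.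
  move=> [a0 /(rV_ballE _ _ r0) v0]; apply/rV_ballE => // i.
  rewrite /cons_rV !mxE; case: fintype.splitP => j ij; rewrite ?mxE//.
  by have := v0 j; rewrite mxE.
rewrite product_measure1E//; last 2 first.
- exact: measurable_ball.
- exact: measurable_ball_rV.
by rewrite [X in (X * _)%E](lebesgue_measure_ball _ (ltW r0)) [X in (_ * X)%E]IH exprS EFinM.
Qed.

Lemma lebesgue_Rd_ball n (r : R) : 0 < r ->
  lebesgue_Rd (ball (0 : 'rV[R]_n) r : set (Rd R n)) = ((r *+ 2) ^+ n)%:E.
Proof.
by move=> r0; rewrite lebesgue_RdE ?lebesgue_borel_ball//; exact: measurable_ball_rV.
Qed.

Lemma measurable_ball_Rd n (x : 'rV[R]_n) (r : R) :
  measurable (ball x r : set (Rd R n)).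
Proof. by apply: open_measurable_Rd; exact: ball_open. Qed.

Lemma compact_lebesgue_Rd_lty n (K : set (Rd R n)) :
  compact (K : set 'rV[R]_n) -> (lebesgue_Rd K < +oo)%E.
Proof.
move=> cK; have [M [Mr KM]] := compact_bounded cK.
pose r := Num.max 0 M + 2.
have r0 : 0 < r by rewrite /r ltr_wpDl// le_max lexx.
apply: (@le_lt_trans _ _ (@lebesgue_Rd R n (ball (0 : 'rV[R]_n) r))); last first.
  by rewrite lebesgue_Rd_ball// ltry.
apply: le_measure; rewrite ?inE.
- exact: compact_measurable_Rd.
- exact: measurable_ball_Rd.
move=> x Kx; rewrite -ball_normE /ball_/= sub0r normrN.
apply: (@le_lt_trans _ _ (Num.max 0 M + 1)); last by rewrite /r ltrD2l ltr1n.
by apply: KM => //; rewrite (@le_lt_trans _ _ (Num.max 0 M))// ?le_max ?lexx ?orbT// ltrDl.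
Qed.

Lemma eball1_sub_ball n : @eball R n 1 `<=` (closed_ball (0 : 'rV[R]_n) 1 : set _).
Proof.
move=> x /= x1; rewrite closed_ballE// /closed_ball_/= sub0r normrN.
rewrite [leLHS]mx_normrE; apply: bigmax_le => // -[i j] _ /=; rewrite ord1.
apply: le_trans (ltW x1); rewrite /enorm -sqrtr_sqr ler_wsqrtr//.
by rewrite (bigD1 j)//= lerDl sumr_ge0// => k _; exact: sqr_ge0.
Qed.

Lemma ball_sub_eball n (r : R) : (0 < n)%N -> 0 < r ->
  (ball (0 : 'rV[R]_n) (r / n%:R) : set _) `<=` @eball R n r.
Proof.
move=> n0 r0 x; have n0' : 0 < n%:R :> R by rewrite ltr0n.
move=> /(rV_ballE _ _ (divr_gt0 r0 n0')) x1; rewrite /eball/= /enorm.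
rewrite -[ltRHS](ger0_norm (ltW r0)) -sqrtr_sqr ltr_sqrt; last by rewrite exprn_gt0.
apply: (@lt_le_trans _ _ (\sum_(i < n) (r / n%:R) ^+ 2)).
  apply: ltr_sum; first by apply/hasP; exists (Ordinal n0) => //; exact: mem_index_enum.
  move=> i _; have := x1 i; rewrite mxE sub0r normrN => xi.
  rewrite -(real_normK (num_real (x 0 i))) ltr_pXn2r// nnegrE//.
  by rewrite divr_ge0// ltW.
rewrite sumr_const card_ord -[X in X <= _]mulr_natl.
have -> : n%:R * (r / n%:R) ^+ 2 = r ^+ 2 / n%:R by field; rewrite gt_eqF.
by rewrite ler_pdivrMr// ler_peMr ?sqr_ge0// ler1n.
Qed.

End balls.

(** * Borel representatives for a completed measure *)

Section nonmeasurable_monotonicity.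
Local Open Scope ereal_scope.
Context d (T : measurableType d) (R : realType) (mu : {measure set T -> \bar R}).

Import HBNNSimple.

(** The integral of a nonnegative function is the supremum of the integrals of the
    simple functions below it, hence monotone even without measurability. *)
Lemma ge0_le_integral_lower (f g : T -> \bar R) : (forall x, 0 <= f x) ->
  (forall x, f x <= g x) -> \int[mu]_x f x <= \int[mu]_x g x.
Proof.
move=> f0 fg; have g0 x : 0 <= g x by exact: le_trans (f0 x) (fg x).
rewrite !ge0_integralTE//; apply: le_ereal_sup => _ [h hf <-].
by exists h => // x; exact: le_trans (hf x) (fg x).
Qed.

End nonmeasurable_monotonicity.

Section completion_representatives.
Context d (T : measurableType d) (R : realType).
Variable m : {sigma_finite_measure set T -> \bar R}.
Local Notation cT := (caratheodory_type m^*%mu).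

(** The intersection of countable covers whose total measures approach the outer
    measure of A. *)
Lemma measurable_hull (A : set T) : (m^*%mu A < +oo)%E ->
  exists B, [/\ measurable B, A `<=` B & m B = m^*%mu A].
Proof.
move=> Aoo.
have cov n : exists F, @measurable_cover _ T A F /\
    (\sum_(k <oo) m (F k) < m^*%mu A + n.+1%:R^-1%:E)%E.
  have n0 : (0 < n.+1%:R^-1 :> R)%R by rewrite invr_gt0.
  have : m^*%mu A \is a fin_num by rewrite ge0_fin_numE// mu_ext_ge0.
  by move/(lb_ereal_inf_adherent n0) => [_ [F AF <-] ?]; exists F.
have [F FP] := choice cov.
pose B := \bigcap_n \bigcup_k F n k.
have mB : measurable B.
  apply: bigcapT_measurable => n; apply: bigcupT_measurable => k.
  exact: (FP n).1.1.
have AB : A `<=` B by move=> x Ax n _; exact: (FP n).1.2.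
exists B; split => //; apply/eqP; rewrite eq_le; apply/andP; split; last first.
  by rewrite -[leRHS]measurable_mu_extE//; exact: le_mu_ext.
apply/lee_addgt0Pr => e e0.
have [n ne] : exists n : nat, n.+1%:R^-1 < e.
  exists (Num.truncn e^-1).
  by rewrite -[ltRHS]invrK ltf_pV2 ?posrE ?invr_gt0// truncnS_gt.
apply: (@le_trans _ _ (m (\bigcup_k F n k))).
  apply: le_measure; rewrite ?inE//; last by move=> x /(_ n); exact.
  by apply: bigcupT_measurable => k; exact: (FP n).1.1.
apply: (@le_trans _ _ (\sum_(k <oo) m (F n k))%E).
  apply: measure_sigma_subadditive => //; first by move=> k; exact: (FP n).1.1.
  by apply: bigcupT_measurable => k; exact: (FP n).1.1.
by rewrite (le_trans (ltW (FP n).2))// leeD2l// lee_fin ltW.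
Qed.

(** On a piece of finite measure, a measurable hull of A exceeds A by a set of outer
    measure 0, which has itself a null hull; countably many pieces suffice. *)
Lemma caratheodory_set_representative (A : set T) : measurable (A : set cT) ->
  exists B N, [/\ measurable B, measurable N, m N = 0%E &
                  forall x, ~ N x -> A x <-> B x].
Proof.
move=> mA; have [F TF mF] := sigma_finiteT m.
have mFc n : measurable (F n : set cT).
  by apply: caratheodory_measurable_mu_ext; have [] := mF n.
have piece n : exists BN : set T * set T, [/\ measurable BN.1, measurable BN.2, m BN.2 = 0%E,
    A `&` F n `<=` BN.1 & BN.1 `\` (A `&` F n) `<=` BN.2].
  have mAF : measurable (A `&` F n : set cT) by exact: measurableI.
  have AFoo : (m^*%mu (A `&` F n) < +oo)%E.
    apply: le_lt_trans (mF n).2; rewrite -[leRHS]measurable_mu_extE; last by have [] := mF n.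
    by apply: le_mu_ext; exact: subIsetr.
  have [B [mB AB BE]] := measurable_hull AFoo.
  have mBc : measurable (B : set cT) by exact: caratheodory_measurable_mu_ext.
  have B0 : m^*%mu (B `\` (A `&` F n)) = 0%E.
    have Bs : m^*%mu B = m^*%mu (A `&` F n) by rewrite -BE; exact: measurable_mu_extE.
    have : (m^*%mu B < +oo)%E -> (m^*%mu (B `\` (A `&` F n)) =
        m^*%mu B - m^*%mu (B `&` (A `&` F n)))%E.
      exact: (@measureD _ cT R (@completed_measure_extension _ _ _ m) _ _ mBc mAF).
    rewrite Bs (setIidr AB) => /(_ AFoo) ->.
    by rewrite subee// ge0_fin_numE// mu_ext_ge0.
  have [|N [mN BN NE]] := @measurable_hull (B `\` (A `&` F n)); first by rewrite B0.
  by exists (B, N); split => //=; rewrite NE.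
have [BN BNP] := choice piece.
exists (\bigcup_n (BN n).1), (\bigcup_n (BN n).2); split.
- by apply: bigcupT_measurable => n; have [] := BNP n.
- by apply: bigcupT_measurable => n; have [] := BNP n.
- apply/measure_negligible; first by apply: bigcupT_measurable => n; have [] := BNP n.
  apply: negligible_bigcup => n; have [_ mN N0 _ _] := BNP n.
  exact/negligibleP.
move=> x Nx; split => [Ax|[n _ Bx]].
  have : (\bigcup_n F n) x by rewrite -TF.
  by move=> [n _ Fnx]; exists n => //; have [_ _ _ + _] := BNP n; apply.
apply: contrapT => nAx; apply: Nx; exists n => //.
by have [_ _ _ _] := BNP n; apply; split => // -[].
Qed.

(** The sets where f < q, for q rational, are Borel up to null sets; the union of
    these countably many null sets is removed. *)
Lemma caratheodory_fun_representative (f : cT -> R) :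
  measurable_fun setT f ->
  exists N : set T, [/\ measurable N, m N = 0%E & measurable_fun (~` N) (f : T -> R)].
Proof.
move=> mf.
have lev (q : rat) : exists BN : set T * set T, [/\ measurable BN.1, measurable BN.2, m BN.2 = 0%E &
    forall x, ~ BN.2 x -> f x < ratr q <-> BN.1 x].
  have mA : measurable ([set x | f x < ratr q] : set cT).
    rewrite -[X in measurable X]setTI.
    have := mf measurableT `]-oo, (ratr q : R)[%classic (measurable_itv _).
    by congr (measurable _); apply/seteqP; split => x; rewrite /= in_itv.
  by have [B [N [? ? ? ?]]] := caratheodory_set_representative mA; exists (B, N).
have [BN BNP] := choice lev.
(* The rationals are enumerated through their codes. *)
pose Nn n := if unpickle n is Some q then (BN q).2 else set0.
have mNn n : measurable (Nn n).
  by rewrite /Nn; case: unpickle => // q; have [] := BNP q.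
pose N := \bigcup_n Nn n.
have mN : measurable N by exact: bigcupT_measurable.
have NnN q : (BN q).2 `<=` N.
  by move=> x Nx; exists (pickle q); [by []|rewrite /Nn pickleK].
exists N; split => //.
  apply/measure_negligible => //; apply: negligible_bigcup => n.
  apply/negligibleP => //; rewrite /Nn; case: unpickle => [q|]; last exact: measure0.
  by have [] := BNP q.
have mD := measurableC mN.
apply: (measurability (@RGenInftyO.G R)); first exact: RGenInftyO.measurableE.
move=> _ [_ [a ->] <-].
rewrite (_ : _ `&` _ = ~` N `&` \bigcup_(q in [set q : rat | ratr q < a]) (BN q).1).
  apply: measurableI => //; rewrite bigcup_mkcond; apply: countable_bigcupT_measurable => // q.
  by case: ifPn => // _; have [] := BNP q.
apply/seteqP; split => x [Nx] /=.
  rewrite in_itv/= => fxa; split => //.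
  have [q] := rat_in_itvoo fxa; rewrite in_itv/= => /andP[fq qa].
  exists q => //; have [_ _ _ /(_ x) BE] := BNP q; apply/BE => //.
  by move=> Bx; apply: Nx; exact: NnN Bx.
move=> [q /= qa Bx]; split => //=; rewrite in_itv/=; apply: lt_trans qa.
have [_ _ _ /(_ x) BE] := BNP q; apply/BE => //.
by move=> Nqx; apply: Nx; exact: NnN Nqx.
Qed.

End completion_representatives.

(** * Total boundedness *)

Section total_boundedness.
Context (R : realType) (X : Type) (Y : pseudoMetricType R).
Variables (S : set X) (F : X -> Y).

(** Finite colourings whose colour classes consist of mutually close points: total
    boundedness, phrased on the source of a map, and for an arbitrary relation
    of closeness so that several such colourings can be refined together. *)
Definition finitely_split (close : X -> X -> Prop) :=
  exists n (c : X -> nat), (forall x, S x -> (c x < n)%N) /\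
    forall x y, S x -> S y -> c x = c y -> close x y.

Lemma precompact_finitely_split e : 0 < e -> precompact (F @` S) ->
  finitely_split (fun x y => ball (F x) e (F y)).
Proof.
move=> e0; rewrite precompactE => /compact_near_coveringP cov.
have e20 : 0 < e / 2 by rewrite divr_gt0.
(* Near covering along the finite lists of centres, ordered by inclusion. *)
pose G : set_system (seq Y) := filter_from setT (fun s0 : seq Y => [set s : seq Y | {subset s0 <= s}]).
have FG : Filter G.
  apply: filter_from_filter; first by exists [::].
  move=> s1 s2 _ _; exists (s1 ++ s2) => // s /= ss.
  by split=> y ys; apply: ss; rewrite mem_cat ys ?orbT.
have [|D _ DP0] := cov _ G (fun (s : seq Y) x => exists2 y, y \in s & ball y (e / 2) x) FG.
  move=> x _; exists (ball x (e / 2), [set s : seq Y | x \in s]) => /=; last first.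
    by move=> [y s] /= [xy xs]; exists x.
  split; first exact: nbhsx_ballx.
  by exists [:: x] => // s /= ss; apply: ss; rewrite mem_head.
have DS : forall y, closure (F @` S) y -> exists2 z, z \in D & ball z (e / 2) y.
  exact: DP0.
pose P x (y : Y) := `[< ball y (e / 2) (F x) >].
have DP x : S x -> has (P x) D.
  move=> Sx; have [y /= yD yx] := DS (F x) (subset_closure (imageP F Sx)).
  by apply/hasP; exists y => //; apply/asboolP; exact: yx.
exists (size D), (fun x => find (P x) D); split.
  by move=> x /DP; rewrite has_find.
move=> x x' Sx Sx' xx'; have xy := nth_find (F x) (DP _ Sx).
have x'y := nth_find (F x) (DP _ Sx'); rewrite -xx' in x'y.
move: xy x'y => /asboolP xy /asboolP x'y; exact: ball_splitr xy x'y.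
Qed.

(** Sequences with geometrically small steps are those produced by colour classes at
    geometric scales, and those for which L^p limits exist almost everywhere. *)
Definition rapidly_complete := forall u : nat -> Y,
  (forall n, ball (u n) (4^-1 ^+ n) (u n.+1)) ->
  exists l, forall e, 0 < e -> exists N, forall n, (N <= n)%N -> ball l e (u n).

Lemma ultra_finite_cases (U : set_system Y) (A : set Y) n (c : Y -> nat) :
  UltraFilter U -> U A -> (forall y, A y -> (c y < n)%N) ->
  exists k, U [set y | A y /\ c y = k].
Proof.
move=> UU; elim: n A => [|n IH] A UA cA.
  have := @filter_ex _ U _ A UA; move=> [y /cA]; by rewrite ltn0.
have [Un|Un] := in_ultra_setVsetC [set y | c y = n] UU.
  by exists n; apply: filterS2 UA Un => y Ay.
have [|y|k Uk] := IH (A `&` [set y | c y <> n]).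
- exact: filterI.
- by move=> [Ay /= cn]; have := cA _ Ay; rewrite ltnS leq_eqVlt => /predU1P[].
by exists k; apply: filterS Uk => y [[]].
Qed.

(** An ultrafilter on the closure contains, at each scale, a colour class; choosing
    points in the intersections of the first n classes gives a rapidly convergent
    sequence, whose limit is a limit of the ultrafilter. *)
Lemma finitely_split_precompact : rapidly_complete ->
  (forall e, 0 < e -> finitely_split (fun x y => ball (F x) e (F y))) ->
  precompact (F @` S).
Proof.
move=> Yc Sfin; rewrite precompactE compact_ultra => U UU UclS.
set A := closure (F @` S).
have pos n : 0 < 4^-1 ^+ n :> R by rewrite exprn_gt0// invr_gt0.
have cells n : exists B : set Y, [/\ U B, B `<=` A &
    forall y z, B y -> B z -> ball y (4^-1 ^+ n) z].
  pose e := 4^-1 ^+ n / 4 : R; have e0 : 0 < e by rewrite divr_gt0.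
  have [N [c [cN cb]]] := Sfin _ e0.
  have near_S y : exists x, A y -> S x /\ ball y e (F x).
    have [Ay|nAy] := pselect (A y); last first.
      have [x0 Ax0] := @filter_ex _ U _ A UclS.
      have [_ [[x Sx _] _]] := Ax0 _ (nbhsx_ballx x0 _ e0).
      by exists x.
    have [_ [[x Sx <-] yx]] := Ay _ (nbhsx_ballx y _ e0).
    by exists x.
  have [a aP] := choice near_S.
  have [|k Uk] := @ultra_finite_cases U A N (c \o a) UU UclS.
    by move=> y /aP[Say _]; exact: cN.
  exists [set y | A y /\ (c \o a) y = k]; split => // [y []//|y z [Ay cy] [Az cz]].
  have [Say ya] := aP _ Ay; have [Saz za] := aP _ Az.
  rewrite (_ : _ ^+ n = e + e + (e + e)); last by rewrite /e; field.
  apply: (@ball_triangle _ _ (F (a z))).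
    apply: ball_triangle ya _; apply: cb => //.
    by rewrite -[LHS]/((c \o a) y) cy -cz.
  apply: ball_sym; apply: le_ball za; by rewrite lerDl ltW.
have [B BP] := choice cells.
have Bcap n : U (\bigcap_(k < n.+1) B k).
  elim: n => [|n IH].
    have [U0 _ _] := BP 0%N; apply: filterS U0 => y B0y k /=.
    by rewrite ltnS leqn0 => /eqP->.
  have [Un _ _] := BP n.+1; apply: filterS2 IH Un => y yn Bny k /=.
  by rewrite ltnS leq_eqVlt => /predU1P[->//|kn]; exact: yn.
have ex n : exists y, (\bigcap_(k < n.+1) B k) y by exact: (@filter_ex _ U).
have [u uP] := choice ex.
have [|l lP] := Yc u.
  move=> n; have [_ _] := BP n; apply; first by apply: uP => /=.
  by apply: uP => /=; rewrite ltnS leqnSn.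
exists l; split.
  rewrite (closure_id A).1; last exact: closed_closure.
  move=> V /nbhs_ballP[e /= e0 eV]; have [N NP] := lP _ e0.
  exists (u N); split; last by apply: eV; exact: NP.
  by have [_ + _] := BP N; apply; apply: uP => /=.
move=> V /nbhs_ballP[e /= e0 eV].
have e20 : 0 < e / 2 by rewrite divr_gt0.
have [N NP] := lP _ e20.
have [M Me] : exists M, (N <= M)%N /\ 4^-1 ^+ M < e / 2 :> R.
  have := @cvg_expr R 4^-1; rewrite ger0_norm ?invr_ge0// invf_lt1// ltr1n => /(_ isT).
  move=> /cvgrPdist_lt/(_ _ e20)[K _ KP]; exists (maxn N K); split; first exact: leq_maxl.
  by have := KP (maxn N K) (leq_maxr _ _); rewrite /= sub0r normrN ger0_norm// ltW.
have [UM _ BM] := BP M.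
apply: filterS UM => y By; apply: eV; rewrite (splitr e).
apply: (@ball_triangle _ _ (u M)); first by apply: NP; exact: Me.1.
apply: (@le_ball _ _ _ (4^-1 ^+ M)); first exact: ltW Me.2.
by apply: BM => //; apply: uP => /=.
Qed.

End total_boundedness.

Section finitely_split_ops.
Context (X : Type).
Implicit Types S : set X.

Lemma finitely_split_sub S S' (r r' : X -> X -> Prop) : S' `<=` S ->
  (forall x y, S' x -> S' y -> r x y -> r' x y) -> finitely_split S r -> finitely_split S' r'.
Proof.
move=> SS rr [n [c [cn cr]]]; exists n, c; split; first by move=> x /SS /cn.
by move=> x y Sx Sy cxy; apply: rr => //; apply: cr => //; exact: SS.
Qed.

(** The common refinement of the two colourings: pairs of colours. *)
Lemma finitely_splitI S (r1 r2 : X -> X -> Prop) :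
  finitely_split S r1 -> finitely_split S r2 ->
  finitely_split S (fun x y => r1 x y /\ r2 x y).
Proof.
move=> [n1 [c1 [cn1 cr1]]] [n2 [c2 [cn2 cr2]]].
exists (n1 * n2)%N, (fun x => c1 x * n2 + c2 x)%N; split.
  move=> x Sx; have c1x := cn1 _ Sx; have c2x := cn2 _ Sx.
  by apply: (@leq_trans ((c1 x).+1 * n2)%N); [rewrite mulSn addnC ltn_add2r|rewrite leq_mul2r c1x orbT].
move=> x y Sx Sy cxy.
have n20 : (0 < n2)%N by exact: leq_ltn_trans (leq0n _) (cn2 _ Sx).
have e1 : c1 x = c1 y.
  have := congr1 (divn^~ n2) cxy; rewrite !divnMDl// !divn_small ?addn0//; exact: cn2.
split; first exact: cr1.
by apply: cr2 => //; move: cxy; rewrite e1 => /addnI.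
Qed.

End finitely_split_ops.

Section finitely_split_functionals.
Context (X : Type) (R : realType) (S : set X).

(** Cut the range [-B, B] of the functional into intervals of length tau. *)
Lemma finitely_split_bounded (l : X -> R) (B tau : R) : 0 < tau ->
  (forall u, S u -> `|l u| <= B) ->
  finitely_split S (fun u v => `|l u - l v| <= tau).
Proof.
move=> tau0 lB; pose c u := Num.truncn ((l u + B) / tau).
have c_ge0 u : S u -> 0 <= (l u + B) / tau.
  move=> /lB; rewrite ler_norml => /andP[lo _].
  by rewrite divr_ge0 ?(ltW tau0)// -lerBlDr sub0r.
have c_le u : S u -> (c u)%:R <= (l u + B) / tau < (c u).+1%:R.
  by move=> Su; rewrite truncn_le ?c_ge0// truncnS_gt.
exists (Num.truncn ((B + B) / tau)).+1, c; split.
  move=> u Su; rewrite -(ltr_nat R).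
  have /andP[+ _] := c_le _ Su => /le_lt_trans; apply.
  apply: (@le_lt_trans _ _ ((B + B) / tau)); last exact: truncnS_gt.
  rewrite ler_pM2r ?invr_gt0// lerD2r; exact: le_trans (ler_norm _) (lB _ Su).
move=> u v Su Sv cuv; have /andP[u1 u2] := c_le _ Su; have /andP[v1 v2] := c_le _ Sv.
rewrite cuv in u1 u2.
rewrite -[leRHS]mul1r -ler_pdivrMr// -[X in _ / X](gtr0_norm tau0) -normf_div.
rewrite (_ : (l u - l v) / tau = (l u + B) / tau - (l v + B) / tau); last by ring.
rewrite ler_norml; move: u1 u2 v1 v2; rewrite -natr1 => u1 u2 v1 v2.
by apply/andP; split; lra.
Qed.

Lemma finitely_split_all (n : nat) (r : nat -> X -> X -> Prop) :
  (forall j, finitely_split S (r j)) ->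
  finitely_split S (fun u v => forall j, (j < n)%N -> r j u v).
Proof.
move=> sr; elim: n => [|n IH]; first by exists 1%N, (fun=> 0%N).
apply: finitely_split_sub (finitely_splitI IH (sr n)) => // u v _ _ [h1 h2] j.
by rewrite ltnS leq_eqVlt => /predU1P[->//|]; exact: h1.
Qed.

End finitely_split_functionals.

(** * The spaces L^p: distances, representatives, completeness *)

Section powR_facts.
Context (R : realType).
Implicit Types a b t p : R.

Lemma powR_ltP a b p : 0 < p -> 0 <= a -> 0 <= b -> (a `^ p < b `^ p) = (a < b).
Proof.
move=> p0 a0 b0; apply/idP/idP; last exact: gt0_ltr_powR.
by apply: contraTT; rewrite -!leNgt => ba; apply: ge0_ler_powR => //; exact: ltW.
Qed.

Lemma powR_leP a b p : 0 < p -> 0 <= a -> 0 <= b -> (a `^ p <= b `^ p) = (a <= b).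
Proof. by move=> p0 a0 b0; rewrite !leNgt powR_ltP. Qed.

(** The constant 2^p, rather than 2^(p-1), comes from the bound |a + b| <= 2 max(|a|, |b|). *)
Lemma powR_normD a b p : 0 <= p -> `|a + b| `^ p <= 2 `^ p * (`|a| `^ p + `|b| `^ p).
Proof.
move=> p0; set M := Num.max `|a| `|b|.
have M0 : 0 <= M by rewrite le_max normr_ge0.
apply: (@le_trans _ _ ((2 * M) `^ p)).
  apply: ge0_ler_powR => //; rewrite ?nnegrE ?mulr_ge0//.
  by rewrite mulr_natl mulr2n (le_trans (ler_normD _ _))// lerD// le_max lexx ?orbT.
rewrite powRM// ler_wpM2l ?powR_ge0// /M.
by case: (leP `|a| `|b|) => _; rewrite ?lerDl ?lerDr powR_ge0.
Qed.

Lemma powR_normB a b p : 0 <= p -> `|a - b| `^ p <= 2 `^ p * (`|a| `^ p + `|b| `^ p).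
Proof. by move=> p0; rewrite -(normrN b); exact: powR_normD. Qed.

End powR_facts.

Section Lspace_realizations.
Context d (T : measurableType d) (R : realType) (mu : {measure set T -> \bar R}).
Variables (p : R) (p1 : (1 <= p%:E)%E).
Local Notation LT := (LspaceType mu p1).

Let p0 : 0 < p. Proof. by rewrite (lt_le_trans ltr01)// -lee_fin. Qed.

Lemma measurable_Lspace (f : LT) : measurable_fun setT (f : T -> R).
Proof.
have mf : measurable_fun setT (f : T -> measurableTypeR R) by exact: measurable_funPT.
exact: mf.
Qed.

Lemma measurable_powR_norm (f : T -> R) : measurable_fun setT f ->
  measurable_fun setT (fun x => (`|f x| `^ p)%:E).
Proof.
move=> mf; apply/measurable_EFinP.
apply: (@measurableT_comp _ _ _ _ _ _ (fun x : R => x `^ p)) => //.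
exact: measurableT_comp.
Qed.

Lemma Lnorm_powR (f : T -> R) :
  ('N[mu]_p%:E[EFin \o f] `^ p = \int[mu]_x (`|f x| `^ p)%:E)%E.
Proof. by rewrite poweR_Lnorm ?gt_eqF//; apply: eq_integral => x _ /=; rewrite poweR_EFin. Qed.

Lemma Lnorm_ltP (f : T -> R) e : 0 < e ->
  ('N[mu]_p%:E[EFin \o f] < e%:E)%E = (\int[mu]_x (`|f x| `^ p)%:E < (e `^ p)%:E)%E.
Proof.
move=> e0; rewrite -Lnorm_powR; set N := ('N[mu]_p%:E[_])%E.
have : (0 <= N)%E by exact: Lnorm_ge0.
case: N => [r r0||]//; last by move=> _; rewrite poweRyr ?gt_eqF.
by rewrite poweR_EFin !lte_fin powR_ltP// ltW.
Qed.

Lemma finite_normP (f : T -> R) :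
  (finite_norm mu p%:E f) <-> (\int[mu]_x (`|f x| `^ p)%:E < +oo)%E.
Proof.
rewrite /finite_norm -Lnorm_powR; split=> [|]; first exact: poweR_lty.
by apply: lty_poweRy; rewrite gt_eqF.
Qed.

(** Comparing p-th powers of norms keeps the whole argument at the level of integrals. *)
Lemma Lspace_ballE (f g : LT) e : 0 < e ->
  ball f e g <-> (\int[mu]_x (`|(f x : R) - g x| `^ p)%:E < (e `^ p)%:E)%E.
Proof. by move=> e0; rewrite -(Lnorm_ltP (fun x => (f x : R) - g x)). Qed.

Lemma Lspace_integral_lty (f : LT) : (\int[mu]_x (`|(f x : R)| `^ p)%:E < +oo)%E.
Proof. exact/finite_normP/Lebesgue_finite. Qed.

Lemma ae_eq_integral_powR (f g : T -> R) : measurable_fun setT f -> measurable_fun setT g ->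
  f = g %[ae mu] -> (\int[mu]_x (`|f x| `^ p)%:E = \int[mu]_x (`|g x| `^ p)%:E)%E.
Proof.
move=> mf mg fg; apply: ge0_ae_eq_integral => //.
- exact: measurable_powR_norm.
- exact: measurable_powR_norm.
- by apply: filterS fg => x /(_ I) fgx _; rewrite fgx.
Qed.

(** Elements of L^p are classes: this makes explicit functions, such as limits and bumps,
    available as elements. *)
Lemma Lspace_realize (f : T -> measurableTypeR R) : measurable_fun setT f ->
  (\int[mu]_x (`|f x : R| `^ p)%:E < +oo)%E ->
  exists v : LT, (v : T -> measurableTypeR R) = f %[ae mu].
Proof.
move=> mf foo; pose f' : {mfun T >-> measurableTypeR R} :=
  HB.pack f (isMeasurableFun.Build _ _ _ _ _ mf).
pose c : {mfun_ mu, T >-> measurableTypeR R} := \pi%qT f'.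
have cf : (c : T -> measurableTypeR R) = f %[ae mu].
  have /eqP := reprK c.
  by rewrite {2}/c eqmodE => /asboolP.
have cfin : finite_norm mu p%:E c.
  apply/finite_normP; rewrite (ae_eq_integral_powR _ _ cf)//.
  have mc : measurable_fun setT (c : T -> measurableTypeR R) by exact: measurable_funPT.
  exact: mc.
pose v : LT := HB.pack c (isFinLebesgue.Build _ _ _ mu _ p1 c cfin).
by exists v.
Qed.

End Lspace_realizations.

Section riesz_fischer.
Context d (T : measurableType d) (R : realType) (mu : {measure set T -> \bar R}).
Variables (p : R) (p1 : (1 <= p%:E)%E).
Local Notation LT := (LspaceType mu p1).

Let p_ge1 : 1 <= p. Proof. by rewrite -lee_fin. Qed.
Let p0 : 0 < p. Proof. exact: lt_le_trans p_ge1. Qed.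

Lemma nneseries_half_le (a : nat -> \bar R) :
  (forall n, 0 <= a n <= (2^-1 ^+ n)%:E)%E -> (\sum_(n <oo) a n <= 2%:E)%E.
Proof.
move=> a0; apply: lime_le.
  by apply: is_cvg_nneseries => n _ _; have /andP[] := a0 n.
apply: nearW => k.
apply: (@le_trans _ _ (\sum_(0 <= n < k) (2^-1 ^+ n)%:E)%E).
  by apply: lee_sum => n _; have /andP[] := a0 n.
rewrite sumEFin lee_fin.
have := @geometric_le_lim R k 1 2^-1 ler01; rewrite invr_gt0 ltr0n => /(_ isT).
rewrite ger0_norm ?invr_ge0// invf_lt1// ltr1n => /(_ isT).
rewrite mul1r (_ : (1 - 2^-1)^-1 = 2); last by field.
apply: le_trans; rewrite /series/= le_eqVlt; apply/orP; left; apply/eqP.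
by apply: eq_bigr => i _; rewrite mul1r.
Qed.

(** The upper limit is a total, measurable candidate for the limit, and the error
    bound comes from summing the geometric tail. *)
Lemma rapid_limn_esup (v : nat -> R) (c : R) : 0 <= c ->
  (forall n, `|v n - v n.+1| <= c * 2^-1 ^+ n) ->
  forall n, `|v n - fine (limn_esup (EFin \o v))| <= 2 * c * 2^-1 ^+ n.
Proof.
move=> c0 vc n.
have tail k : `|v n - v (n + k)%N| <= 2 * c * (2^-1 ^+ n - 2^-1 ^+ (n + k)).
  elim: k => [|k IH]; first by rewrite addn0 !subrr normr0 mulr0.
  rewrite addnS; apply: le_trans (ler_distD (v (n + k)%N) _ _) _.
  apply: le_trans (lerD IH (vc _)) _; rewrite exprS le_eqVlt; apply/orP; left; apply/eqP.
  by field.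
set b := 2 * c * 2^-1 ^+ n.
have near_v m : (n <= m)%N -> v n - b <= v m <= v n + b.
  move=> nm; have := tail (m - n)%N; rewrite subnKC// => h.
  have h' : `|v n - v m| <= b.
    apply: le_trans h _; rewrite ler_wpM2l// ?mulr_ge0// gerBl exprn_ge0//.
  by move: h'; rewrite ler_distlC.
have esup_near m : (n <= m)%N ->
    ((v n - b)%:E <= esups (EFin \o v) m <= (v n + b)%:E)%E.
  move=> nm; apply/andP; split.
    apply: (@le_trans _ _ (v m)%:E); first by rewrite lee_fin; have /andP[] := near_v m nm.
    by apply: ereal_sup_ubound; exists m => //=.
  apply: ge_ereal_sup => _ [k /= mk <-]; rewrite lee_fin.
  by have /andP[] := near_v k (leq_trans nm mk).
have lo : ((v n - b)%:E <= limn_esup (EFin \o v))%E.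
  rewrite limn_esup_lim; apply: lime_ge; first exact: is_cvg_esups.
  by exists n => // m /= /esup_near/andP[].
have hi : (limn_esup (EFin \o v) <= (v n + b)%:E)%E.
  rewrite limn_esup_lim; apply: lime_le; first exact: is_cvg_esups.
  by exists n => // m /= /esup_near/andP[].
have fin : limn_esup (EFin \o v) \is a fin_num.
  by rewrite fin_numE; apply/andP; split; apply/eqP => E; move: lo hi; rewrite E.
rewrite ler_distlC -!lee_fin fineK//.
by rewrite lo hi.
Qed.

(** With steps 4^-n in norm, the sum h over n of 2^(np) |u_n - u_(n+1)|^p is
    integrable, hence finite almost everywhere.  Where h is finite the steps are at
    most h^(1/p) 2^-n, so the sequence converges and the p-th power of the error is
    at most a multiple of 2^(-np) h, which is integrable. *)
Lemma Lspace_rapidly_complete : @rapidly_complete R LT.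
Proof.
move=> u uP.
have mu_ n := measurable_Lspace (u n).
pose g n x : \bar R := (`|(u n x : R) - u n.+1 x| `^ p)%:E.
have mg n : measurable_fun setT (g n).
  by apply: measurable_powR_norm => //; exact: measurable_funB.
have g0 n x : (0 <= g n x)%E by rewrite lee_fin powR_ge0.
pose w n x : \bar R := (((2 ^+ n) `^ p)%:E * g n x)%E.
have mw n : measurable_fun setT (w n) by exact: measurable_funeM.
have w0 n x : (0 <= w n x)%E by rewrite mule_ge0// lee_fin powR_ge0.
pose h x := (\sum_(n <oo) w n x)%E.
have h0 x : (0 <= h x)%E by exact: nneseries_ge0.
have mh : measurable_fun setT h by exact: ge0_emeasurable_sum.
have ih : (\int[mu]_x h x <= 2%:E)%E.
  rewrite integral_nneseries//; apply: nneseries_half_le => n.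
  rewrite integral_ge0//= /w ge0_integralZl//.
  have gn : (\int[mu]_x g n x <= ((4^-1 ^+ n) `^ p)%:E)%E.
    by apply: ltW; apply/(Lspace_ballE (u n) (u n.+1)); [rewrite exprn_gt0// invr_gt0|exact: uP].
  apply: le_trans (lee_wpmul2l _ gn) _; first by rewrite lee_fin powR_ge0.
  rewrite -EFinM lee_fin -powRM ?exprn_ge0// ?invr_ge0// -exprMn.
  rewrite (_ : 2 / 4 = 2^-1 :> R); last by field.
  case: n {gn} => [|n]; first by rewrite expr0 powR1.
  by apply: ge1r_powR => //; rewrite exprn_gt0 ?invr_gt0//= exprn_ile1// ?invr_ge0// invf_le1// ler1n.
pose f x := fine (limn_esup (fun n => (u n x : R)%:E)).
have mf : measurable_fun setT (f : T -> measurableTypeR R).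
  apply: (measurableT_comp (fine_measurable _)) => //.
  by apply: measurable_fun_limn_esup => n; exact/measurable_EFinP.
have hfin : {ae mu, forall x, h x < +oo}%E.
  have ih' : mu.-integrable setT h.
    apply/integrableP; split => //; under eq_integral do rewrite gee0_abs//.
    by apply: le_lt_trans ih _; rewrite ltry.
  apply: filterS (integrable_ae measurableT ih') => x /(_ I).
  by rewrite ge0_fin_numE.
have dist n : (\int[mu]_x (`|(u n x : R) - f x| `^ p)%:E <=
    ((2 * 2^-1 ^+ n) `^ p)%:E * \int[mu]_x h x)%E.
  rewrite -ge0_integralZl//.
  apply: ae_ge0_le_integral => //.
  - by apply: measurable_powR_norm; exact: measurable_funB.
  - by move=> x _; rewrite mule_ge0// lee_fin powR_ge0.
  - exact: measurable_funeM.
  apply: filterS hfin => x hx _.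
  have hxf : h x \is a fin_num by rewrite ge0_fin_numE.
  pose c := fine (h x) `^ p^-1.
  have cp : c `^ p = fine (h x).
    by rewrite /c -powRrM mulVf ?gt_eqF// powRr1// fine_ge0.
  have step k : `|(u k x : R) - u k.+1 x| <= c * 2^-1 ^+ k.
    have wh : (w k x <= h x)%E.
      apply: le_trans (nneseries_lim_ge (m := 0) k.+1 (fun n _ _ => w0 n x)).
      by rewrite big_nat_recr//= leeDr// sume_ge0.
    have : (2 ^+ k * `|(u k x : R) - u k.+1 x|) `^ p <= c `^ p.
      by rewrite powRM ?exprn_ge0// cp -lee_fin fineK// EFinM; exact: wh.
    rewrite powR_leP ?powR_ge0 ?mulr_ge0 ?exprn_ge0// => le_c.
    by rewrite exprVn ler_pdivlMr ?exprn_gt0// mulrC.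
  have := @rapid_limn_esup (fun k => (u k x : R)) c (powR_ge0 _ _) step n.
  rewrite -/(f x) => le_n; rewrite mulrAC in le_n.
  rewrite -(fineK hxf) -EFinM lee_fin -cp -powRM ?powR_ge0 ?mulr_ge0 ?exprn_ge0//.
  apply: ge0_ler_powR; rewrite ?nnegrE ?mulr_ge0 ?powR_ge0 ?exprn_ge0 ?invr_ge0//.
  exact: ltW.
have ffin : (\int[mu]_x (`|f x : R| `^ p)%:E < +oo)%E.
  apply: (@le_lt_trans _ _ (\int[mu]_x ((2 `^ p)%:E *
      ((`|(u 0%N x : R)| `^ p)%:E + (`|(u 0%N x : R) - f x| `^ p)%:E)))%E).
    apply: ge0_le_integral => //.
    - exact: measurable_powR_norm.
    - apply: measurable_funeM; apply: emeasurable_funD; apply: measurable_powR_norm => //.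
      exact: measurable_funB.
    move=> x _; rewrite -EFinD -EFinM lee_fin.
    by rewrite -[X in `|X| `^ p <= _](subKr (u 0%N x : R)) powR_normB// ltW.
  rewrite ge0_integralZl//; last 2 first.
  - apply: emeasurable_funD; apply: measurable_powR_norm => //.
    exact: measurable_funB.
  - by move=> x _; rewrite adde_ge0// lee_fin powR_ge0.
  rewrite ge0_integralD//; last 2 first.
  - exact: measurable_powR_norm.
  - by apply: measurable_powR_norm; exact: measurable_funB.
  rewrite lte_mul_pinfty ?lee_fin ?powR_ge0// lte_add_pinfty//.
    exact: Lspace_integral_lty.
  apply: le_lt_trans (dist 0%N) _; rewrite lte_mul_pinfty ?lee_fin ?powR_ge0//.
  by apply: le_lt_trans ih _; rewrite ltry.
have [l lf] := Lspace_realize p1 mf ffin.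
exists l => e e0.
have [N NP] : exists N, forall n, (N <= n)%N -> 4 * 2^-1 ^+ n < e :> R.
  have e40 : 0 < e / 4 by rewrite divr_gt0.
  have := @cvg_expr R 2^-1; rewrite ger0_norm ?invr_ge0// invf_lt1// ltr1n => /(_ isT).
  move=> /cvgrPdist_lt/(_ _ e40)[K _ KP]; exists K => n /KP /=.
  by rewrite sub0r normrN ger0_norm ?exprn_ge0 ?invr_ge0// ltr_pdivlMr// mulrC.
exists N => n /NP ne; apply: ball_sym; apply/Lspace_ballE => //.
have -> : (\int[mu]_x (`|(u n x : R) - l x| `^ p)%:E =
    \int[mu]_x (`|(u n x : R) - f x| `^ p)%:E)%E.
  apply: ae_eq_integral_powR.
  - by apply: measurable_funB => //; exact: measurable_Lspace.
  - exact: measurable_funB.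
  by apply: filterS lf => x /(_ I) -> _.
apply: le_lt_trans (dist n) _.
apply: le_lt_trans (lee_wpmul2l _ ih) _; first by rewrite lee_fin powR_ge0.
rewrite -EFinM lte_fin.
apply: (@le_lt_trans _ _ ((2 * 2^-1 ^+ n) `^ p * 2 `^ p)).
  by rewrite ler_wpM2l ?powR_ge0// le1r_powR// ler1n.
rewrite -powRM ?mulr_ge0 ?exprn_ge0 ?invr_ge0//.
by rewrite powR_ltP ?mulr_ge0 ?exprn_ge0 ?invr_ge0 ?ltW// mulrAC -natrM.
Qed.
End riesz_fischer.

Section restriction_distance.
Context d (T : measurableType d) (R : realType) (mu : {measure set T -> \bar R}).
Variables (K : set T) (mK : measurable K) (p : R) (p1 : (1 <= p%:E)%E).

(** The restricted measure does not charge the complement of K. *)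
Lemma ge0_integral_mrestr (f : T -> \bar R) : measurable_fun setT f ->
  (forall x, 0 <= f x)%E ->
  (\int[mrestr mu mK]_x f x = \int[mu]_(x in K) f x)%E.
Proof.
move=> mf f0.
rewrite (@ge0_negligible_integral _ _ _ (mrestr mu mK) setT (~` K))//; last 2 first.
- exact: measurableC.
- by rewrite /= /mrestr setICl measure0.
rewrite setTD setCK; apply: eq_measure_integral => A mA AK.
by rewrite /= /mrestr setIidl.
Qed.

Lemma Lspace_restr_ballE (u v : LspaceType mu p1) e : 0 < e ->
  ball (Lspace_restr mK u) e (Lspace_restr mK v) <->
  (\int[mu]_(x in K) (`|(u x : R) - v x| `^ p)%:E < (e `^ p)%:E)%E.
Proof.
move=> e0; rewrite Lspace_ballE//.
have mB (u' v' : T -> R) : measurable_fun setT u' -> measurable_fun setT v' ->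
    measurable_fun setT (fun x => u' x - v' x) by exact: measurable_funB.
rewrite (@ae_eq_integral_powR _ _ _ (mrestr mu mK) p _ (fun x => (u x : R) - v x)).
- rewrite ge0_integral_mrestr//.
  apply: measurable_powR_norm; apply: mB; exact: measurable_Lspace.
- by apply: mB; exact: measurable_Lspace.
- by apply: mB; exact: measurable_Lspace.
have := aeEqMfun_restrE mK u; have := aeEqMfun_restrE mK v.
by apply: filterS2 => x /(_ I) vx /(_ I) ux _; rewrite -ux -vx.
Qed.

End restriction_distance.

(** * Sections of measurable sets and convolution kernels *)

Section vanishing_in_measure.
Local Open Scope ereal_scope.
Context d (X : measurableType d) (R : realType) (m : {measure set X -> \bar R}).

(** Egorov's idea in a weak form: for a decreasing sequence tending to 0 everywhere,
    the sets where it exceeds eta decrease to the empty set, and |K| < oo. *)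
Lemma vanishing_in_measure (K : set X) (phi : nat -> X -> \bar R) :
  measurable K -> m K < +oo ->
  (forall n, measurable_fun setT (phi n)) ->
  (forall x, nonincreasing_seq (phi ^~ x)) ->
  (forall x, phi ^~ x @ \oo --> 0) ->
  forall eta delta : R, (0 < eta)%R -> (0 < delta)%R ->
  exists n, m (K `&` [set x | eta%:E < phi n x]) <= delta%:E.
Proof.
move=> mK Koo mphi dphi phi0 eta delta eta0 delta0.
pose Z n := K `&` [set x | eta%:E < phi n x].
have mZ n : measurable (Z n).
  by apply: measurableI => //; rewrite -[X in measurable X]setTI; exact: emeasurable_fun_o_infty.
have dZ : nonincreasing_seq Z.
  move=> n k nk; apply/subsetPset => x [Kx /= h]; split => //=.
  by apply: lt_le_trans h _; exact: dphi.
have Z0 : \bigcap_n Z n = set0.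
  apply/seteqP; split => // x Zx.
  have : (phi ^~ x @ \oo) [set y | y < eta%:E].
    by apply: phi0; apply: open_nbhs_nbhs; split; [exact: open_ereal_lt_ereal|rewrite /= lte_fin].
  move=> [n _ /(_ n (leqnn n)) /= h].
  have [_ /= h'] := Zx n I.
  by have := lt_trans h h'; rewrite ltxx.
have Zoo : m (Z 0%N) < +oo by apply: le_lt_trans Koo; apply: le_measure; rewrite ?inE//; exact: subIsetl.
have mcap : measurable (\bigcap_n Z n) by exact: bigcapT_measurable.
have := nonincreasing_cvg_mu Zoo mZ mcap dZ.
rewrite Z0 measure0 => cvgZ.
have : (m \o Z @ \oo) [set y | y < delta%:E].
  by apply: cvgZ; apply: open_nbhs_nbhs; split; [exact: open_ereal_lt_ereal|rewrite /= lte_fin].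
by move=> [n _ /(_ n (leqnn n)) /= h]; exists n; exact: ltW.
Qed.

End vanishing_in_measure.

Lemma EFin_splitr (R : realType) (a : R) : a%:E = ((a / 2)%:E + (a / 2)%:E)%E.
Proof. by rewrite -EFinD -splitr. Qed.

Section section_splitting.
Local Open Scope ereal_scope.
Context d1 d2 (X : measurableType d1) (Y : measurableType d2) (R : realType).
Variables (mX : {measure set X -> \bar R}) (K : set X).
Hypotheses (mK : measurable K) (Koo : mX K < +oo).

Definition symdiff (T : Type) (A B : set T) : set T := (A `\` B) `|` (B `\` A).

Lemma measurable_symdiff (T : measurableType d2) (A B : set T) :
  measurable A -> measurable B -> measurable (symdiff A B).
Proof. by move=> mA mB; apply: measurableU; exact: measurableD. Qed.

(** Up to a small set of x, the map sending x to the section of E over x takes, up to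
    eta in the metric of the measure of symmetric differences, finitely many values. *)
Definition sections_split (mY : set Y -> \bar R) (E : set (X * Y)) :=
  forall eta delta : R, (0 < eta)%R -> (0 < delta)%R ->
  exists Z, [/\ measurable Z, mX (K `&` Z) <= delta%:E &
    finitely_split (K `\` Z)
      (fun x x' => mY (symdiff (xsection E x) (xsection E x')) <= eta%:E)].

(** Passage to increasing limits: the measure of what the n-th set misses in a section
    decreases to 0 for every x, hence uniformly up to a small set of x. *)
Lemma sections_split_approx (mY : {measure set Y -> \bar R}) (E : set (X * Y))
    (F : nat -> set (X * Y)) :
  measurable E -> (forall n, measurable (F n)) ->
  (forall n, sections_split mY (F n)) -> (forall n, F n `<=` E) ->
  nondecreasing_seq F -> \bigcup_n F n = E ->
  (forall x, mY (xsection E x) < +oo) ->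
  (forall n, measurable_fun setT (fun x => mY (xsection (E `\` F n) x))) ->
  sections_split mY E.
Proof.
move=> mE mF sF FE ndF UF Eoo mphi eta delta eta0 delta0.
pose phi n x := mY (xsection (E `\` F n) x).
have mEF n : measurable (E `\` F n) by exact: measurableD.
have dphi x : nonincreasing_seq (phi ^~ x).
  move=> n k nk; apply: le_measure; rewrite ?inE//; try exact: measurable_xsection.
  move=> y; rewrite /xsection/= !inE => -[Exy nF]; split => // Fn; apply: nF.
  by have /subsetPset := ndF _ _ nk; apply.
have phi0 x : phi ^~ x @ \oo --> 0.
  rewrite -(@measure0 _ _ _ mY).
  have -> : set0 = \bigcap_n xsection (E `\` F n) x.
    apply/esym/seteqP; split => // y h.
    have : E (x, y) by have := h 0%N I; rewrite /xsection/= inE => -[].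
    rewrite -UF => -[n _ Fn]; have := h n I.
    by rewrite /xsection/= inE => -[_ nF]; apply: nF.
  apply: nonincreasing_cvg_mu.
  - apply: le_lt_trans (Eoo x); apply: le_measure; rewrite ?inE; try exact: measurable_xsection.
    by apply: le_xsection; exact: subDsetl.
  - by move=> n; exact: measurable_xsection.
  - by apply: bigcapT_measurable => n; exact: measurable_xsection.
  move=> n k nk; apply/subsetPset; apply: le_xsection.
  apply: setDS; exact/subsetPset/ndF.
have eta30 : (0 < eta / 3)%R by rewrite divr_gt0.
have delta20 : (0 < delta / 2)%R by rewrite divr_gt0.
have [n Zn] := vanishing_in_measure mK Koo mphi dphi phi0 eta30 delta20.
have [Z [mZ Zdelta Zsplit]] := sF n _ _ eta30 delta20.
set Z' := [set x | (eta / 3)%:E < mY (xsection (E `\` F n) x)] in Zn.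
have mZ' : measurable Z'.
  by rewrite -[Z']setTI; exact: emeasurable_fun_o_infty.
exists (Z' `|` Z); split; first exact: measurableU.
  rewrite setIUr; apply: le_trans (measureU2 _ _ _) _; try exact: measurableI.
  by rewrite (EFin_splitr delta); exact: leeD.
apply: finitely_split_sub Zsplit.
  by apply: setDS; exact: subsetUr.
move=> x x' [_ nZx] [_ nZx'] xx'.
have small z : ~ (Z' `|` Z) z -> mY (xsection (E `\` F n) z) <= (eta / 3)%:E.
  by move=> nZ; rewrite leNgt; apply/negP => h; apply: nZ; left.
have mEx z : measurable (xsection (E `\` F n) z) by exact: measurable_xsection.
have mSx : measurable (symdiff (xsection (F n) x) (xsection (F n) x')).
  by apply: measurable_symdiff; exact: measurable_xsection.
apply: (@le_trans _ _ (mY (xsection (E `\` F n) x `|`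
   symdiff (xsection (F n) x) (xsection (F n) x') `|` xsection (E `\` F n) x'))).
  apply: le_measure; rewrite ?inE.
  - by apply: measurable_symdiff; exact: measurable_xsection.
  - by apply: measurableU => //; exact: measurableU.
  move=> y; rewrite /symdiff /xsection /setD /= !inE.
  have FE' z : F n (z, y) -> E (z, y) by exact: FE.
  have [Fx|nFx] := pselect (F n (x, y)); have [Fx'|nFx'] := pselect (F n (x', y)); move: (FE' x) (FE' x'); rewrite /=; tauto.
apply: le_trans (measureU2 _ _ _) _ => //; first exact: measurableU.
apply: le_trans (leeD (measureU2 _ _ _) (lexx _)) _ => //.
rewrite (_ : eta = (eta / 3 + eta / 3 + eta / 3)%R); last by field.
by rewrite !EFinD !leeD ?small.
Qed.

Lemma sections_splitU (mY : {measure set Y -> \bar R}) E F :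
  measurable E -> measurable F ->
  sections_split mY E -> sections_split mY F -> sections_split mY (E `|` F).
Proof.
move=> mE mF sE sF eta delta eta0 delta0.
have eta20 : (0 < eta / 2)%R by rewrite divr_gt0.
have delta20 : (0 < delta / 2)%R by rewrite divr_gt0.
have [Z1 [mZ1 Z1d Z1s]] := sE _ _ eta20 delta20.
have [Z2 [mZ2 Z2d Z2s]] := sF _ _ eta20 delta20.
exists (Z1 `|` Z2); split; first exact: measurableU.
  rewrite setIUr; apply: le_trans (measureU2 _ _ _) _; try exact: measurableI.
  by rewrite (EFin_splitr delta); exact: leeD.
have Z1s' : finitely_split (K `\` (Z1 `|` Z2)) (fun x x' =>
    mY (symdiff (xsection E x) (xsection E x')) <= (eta / 2)%:E).
  by apply: finitely_split_sub Z1s => //; apply: setDS; exact: subsetUl.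
have Z2s' : finitely_split (K `\` (Z1 `|` Z2)) (fun x x' =>
    mY (symdiff (xsection F x) (xsection F x')) <= (eta / 2)%:E).
  by apply: finitely_split_sub Z2s => //; apply: setDS; exact: subsetUr.
apply: finitely_split_sub (finitely_splitI Z1s' Z2s') => // x x' _ _ [h1 h2].
have mS (G : set (X * Y)) : measurable G ->
    measurable (symdiff (xsection G x) (xsection G x') : set Y).
  by move=> mG; apply: measurable_symdiff; exact: measurable_xsection.
apply: (@le_trans _ _ (mY (symdiff (xsection E x) (xsection E x') `|`
   symdiff (xsection F x) (xsection F x')))).
  apply: le_measure; rewrite ?inE.
  - exact/mS/measurableU.
  - by apply: measurableU; exact: mS.
  by move=> y; rewrite /symdiff /xsection /= !inE -![(E `|` F) _]/(E _ \/ F _); tauto.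
apply: le_trans (measureU2 _ _ _) _; try exact: mS.
by rewrite (EFin_splitr eta); exact: leeD.
Qed.

(** The sets with the property form a sigma-algebra containing the rectangles: a
    complement has the same symmetric differences of sections, a union of two sets
    is handled by refining colourings, and a countable one by increasing limits. *)
Lemma sections_split_finite_measure (mY : {finite_measure set Y -> \bar R}) E :
  measurable E -> sections_split mY E.
Proof.
pose C := [set E : set (X * Y) | measurable E /\ sections_split mY E].
suff : @measurable _ (X * Y)%type `<=` C by move=> + /[dup] mE => /(_ E) /(_ mE) [].
have triv (E0 : set (X * Y)) : measurable E0 ->
    finitely_split K (fun x x' => xsection E0 x = xsection E0 x') -> C E0.
  move=> mE0 s0; split => // eta delta eta0 delta0; exists set0; split => //.
    by rewrite setI0 measure0 lee_fin ltW.
  apply: finitely_split_sub s0; first exact: subDsetl.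
  move=> x x' _ _ ->; rewrite /symdiff setDv setU0 measure0 lee_fin; exact: ltW.
have sC : sigma_algebra setT C.
  split.
  - by apply: triv => //; exists 1%N, (fun=> 0%N); split => // x y _ _ _; rewrite !xsection0.
  - move=> A [mA sA]; rewrite setTD; split; first exact: measurableC.
    move=> eta delta eta0 delta0; have [Z [mZ Zd Zs]] := sA _ _ eta0 delta0.
    exists Z; split => //; apply: finitely_split_sub Zs => // x x' _ _.
    congr (mY _ <= _); apply/seteqP; split => y; rewrite /symdiff /xsection /= !inE/=.
      by have [|] := pselect (A (x, y)); have [|] := pselect (A (x', y)); tauto.
    by have [|] := pselect (A (x, y)); have [|] := pselect (A (x', y)); tauto.
  - move=> A CA; have mA n : measurable (A n) by have [] := CA n.
    pose F n := \bigcup_(k < n) A k.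
    have CF n : C (F n).
      elim: n => [|n [mF sF]].
        rewrite /F bigcup0//; apply: triv => //; exists 1%N, (fun=> 0%N); split => // x y _ _ _.
      have FS : F n.+1 = F n `|` A n.
        apply/seteqP; split => z.
          move=> [k /=]; rewrite ltnS leq_eqVlt => /predU1P[->|kn] Akz; first by right.
          by left; exists k.
        by move=> [[k /= kn Akz]|Anz]; [exists k => //=; exact: ltnW|exists n => /=].
      rewrite FS; split; first by apply: measurableU => //; exact: (CA n).1.
      by apply: sections_splitU => //; exact: (CA n).2.
    split; first exact: bigcupT_measurable.
    have mU : measurable (\bigcup_k A k) by exact: bigcupT_measurable.
    apply: (@sections_split_approx mY _ F) => //.
    + by move=> n; exact: (CF n).1.
    + by move=> n; exact: (CF n).2.
    + by move=> n z [k _ Akz]; exists k.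
    + move=> n k nk; apply/subsetPset => z [i /= ni Aiz]; exists i => //=.
      exact: leq_trans nk.
    + apply/seteqP; split => z; first by move=> [n _ [k _ Akz]]; exists k.
      by move=> [k _ Akz]; exists k.+1 => //; exists k => /=.
    + by move=> x; rewrite ltey_eq fin_num_measure//; exact: measurable_xsection.
    + by move=> n; apply: measurable_fun_xsection; apply: measurableD => //; exact: (CF n).1.
apply: smallest_sub => // A [] [B mB <-]; rewrite setTI.
  apply: triv; first by rewrite -[X in measurable X]setTI; exact: measurable_fst.
  exists 2%N, (fun x => (x \in B) : nat); split; first by move=> x _; case: (_ \in _).
  move=> x x' _ _ h; have hb : (x \in B) = (x' \in B) by move: h; do 2 case: (_ \in B).
  apply/seteqP; split => y; rewrite /xsection/= !inE /= => Bx; apply/set_mem.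
    by rewrite -hb; exact/mem_set.
  by rewrite hb; exact/mem_set.
apply: triv; first by rewrite -[X in measurable X]setTI; exact: measurable_snd.
by exists 1%N, (fun=> 0%N); split => // x x' _ _ _; apply/seteqP; split => y; rewrite /xsection/= !inE.
Qed.

End section_splitting.

Section sigma_finite_splitting.
Local Open Scope ereal_scope.
Context d1 d2 (X : measurableType d1) (Y : measurableType d2) (R : realType).
Variables (mX : {measure set X -> \bar R}) (K : set X).
Hypotheses (mK : measurable K) (Koo : mX K < +oo).
Variable (mY : {sigma_finite_measure set Y -> \bar R}).

(** Exhaust the second factor by sets of finite measure; the sections are exhausted
    in measure since their own measures are finite. *)
Lemma sections_split_sigma_finite E :
  measurable E -> (forall x, mY (xsection E x) < +oo) -> sections_split mX K mY E.
Proof.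
move=> mE Eoo.
have /sigma_finiteP[B [TB ndB Boo]] := sigma_finiteT mY.
pose F n := E `&` (setT `*` B n).
have mF n : measurable (F n).
  by apply: measurableI => //; apply: measurableX => //; exact: (Boo n).1.
apply: (@sections_split_approx _ _ _ _ _ mX K mK Koo mY E F) => //.
- move=> n eta delta eta0 delta0.
  have [mB Bn] := Boo n.
  have [Z [mZ Zd Zs]] := @sections_split_finite_measure _ _ _ _ _ mX K mK Koo
    (mfrestr mB Bn) E mE eta delta eta0 delta0.
  exists Z; split => //; apply: finitely_split_sub Zs => // x x' _ _.
  congr (_ <= _); rewrite /mfrestr/= /mrestr; congr (mY _).
  by apply/seteqP; split => y; rewrite /symdiff /xsection /F /= !inE/=; tauto.
- by move=> n; exact: subIsetl.
- move=> n k nk; apply/subsetPset => z [Ez [_ Bz]]; split => //; split => //.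
  by have /subsetPset := ndB _ _ nk; apply.
- apply/seteqP; split => z; first by move=> [n _ []].
  move=> Ez; have : (\bigcup_n B n) z.2 by rewrite -TB.
  by move=> [n _ Bn]; exists n.
- by move=> n; apply: measurable_fun_xsection; exact: measurableD.
Qed.

Lemma sections_split_seq (I : eqType) (s : seq I) (E : I -> set (X * Y)) :
  (forall i, sections_split mX K mY (E i)) ->
  forall eta delta : R, (0 < eta)%R -> (0 < delta)%R ->
  exists Z, [/\ measurable Z, mX (K `&` Z) <= delta%:E &
    finitely_split (K `\` Z) (fun x x' => forall i, i \in s ->
      mY (symdiff (xsection (E i) x) (xsection (E i) x')) <= eta%:E)].
Proof.
move=> sE eta + eta0; elim: s => [|i s IH] delta delta0.
  exists set0; split => //; first by rewrite setI0 measure0 lee_fin ltW.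
  by exists 1%N, (fun=> 0%N); split.
have delta20 : (0 < delta / 2)%R by rewrite divr_gt0.
have [Z1 [mZ1 Z1d Z1s]] := IH _ delta20.
have [Z2 [mZ2 Z2d Z2s]] := sE i _ _ eta0 delta20.
exists (Z1 `|` Z2); split; first exact: measurableU.
  rewrite setIUr; apply: le_trans (measureU2 _ _ _) _; try exact: measurableI.
  by rewrite (EFin_splitr delta); exact: leeD.
have sub1 : K `\` (Z1 `|` Z2) `<=` K `\` Z1 by apply: setDS; exact: subsetUl.
have sub2 : K `\` (Z1 `|` Z2) `<=` K `\` Z2 by apply: setDS; exact: subsetUr.
have Z1s' := finitely_split_sub sub1 (fun _ _ _ _ h => h) Z1s.
have Z2s' := finitely_split_sub sub2 (fun _ _ _ _ h => h) Z2s.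
apply: finitely_split_sub (finitely_splitI Z1s' Z2s') => // x x' _ _ [h1 h2] j.
by rewrite inE => /predU1P[->|/h1].
Qed.

End sigma_finite_splitting.

Section convolution_kernel.
Local Open Scope ereal_scope.
Context (R : realType) (n : nat).
Local Notation mu := (@lebesgue_Rd R n).

Import HBNNSimple.

(** Apply the splitting of sections to the level sets of the simple function
    (x, z) |-> w (x - z).  The level 0, whose level set may have infinite measure,
    does not contribute. *)
Lemma convolution_kernel_split (w : {nnsfun borel_rV R n >-> R}) (K : set (Rd R n)) :
  \int[mu]_y (w y)%:E < +oo -> measurable K -> mu K < +oo ->
  forall eta delta : R, (0 < eta)%R -> (0 < delta)%R ->
  exists Z, [/\ measurable Z, mu (K `&` Z) <= delta%:E &
    finitely_split (K `\` Z) (fun x x' : 'rV[R]_n =>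
      \int[mu]_z `|w (x - (z : 'rV[R]_n))%R - w (x' - (z : 'rV[R]_n))%R|%:E <= eta%:E)].
Proof.
move=> woo mK Koo eta delta eta0 delta0.
pose s : seq R := finmap.enum_fset (fset_set (range w)).
have wE a : w a = (\sum_(r <- s) r * \1_(w @^-1` [set r]) a)%R.
  by rewrite {1}(fimfunE w) fsbig_finite.
have s_ge0 r : r \in s -> (0 <= r)%R.
  by rewrite /s in_fset_set// inE => -[y _ <-].
(* The zero level is emptied, which keeps all these sets of finite measure. *)
pose A r : set (borel_rV R n) := if r == 0%R then set0 else w @^-1` [set r].
have mA r : measurable (A r) by rewrite /A; case: ifP.
have Aoo r : mu (A r) < +oo.
  rewrite /A; case: ifPn => [_|r0]; first by rewrite measure0.
  have [rn|rp] := leP r 0%R.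
    rewrite (_ : _ @^-1` _ = set0) ?measure0//; apply/seteqP; split => // y /= wy.
    by move: r0; rewrite eq_le rn -wy fun_ge0.
  have mAr : measurable (w @^-1` [set r] : set (Rd R n)).
    by apply: caratheodory_measurable_mu_ext; exact: measurable_sfunP.
  have : r%:E * mu (w @^-1` [set r]) < +oo.
    apply: le_lt_trans woo; have <- : \int[mu]_y (\1_(w @^-1` [set r]) y)%:E = mu (w @^-1` [set r]).
      by rewrite integral_indic// setIT.
    have m1 : measurable_fun setT (fun y : Rd R n => (\1_(w @^-1` [set r]) y : R)%:E).
      by apply/measurable_EFinP; exact: measurable_indic.
    rewrite -(ge0_integralZl mu measurableT m1); last 2 first.
    - by move=> y _; rewrite lee_fin.
    - by rewrite lee_fin ltW.
    apply: ge0_le_integral_lower => y; rewrite -EFinM lee_fin.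
      by rewrite mulr_ge0// ltW.
    rewrite indicE; have [|_] := boolP (y \in _); last by rewrite mulr0 fun_ge0.
    by rewrite inE => <-; rewrite mulr1.
  by case: (mu (w @^-1` [set r])) => [a _||//]; [exact: ltry|rewrite gt0_muley// lte_fin].
pose E r : set (Rd R n * Rd R n) := [set z | A r ((z.1 : 'rV[R]_n) - (z.2 : 'rV[R]_n))%R].
have mE r : measurable (E r).
  by rewrite -[X in measurable X]setTI; exact: (@measurable_sub_Rd R n).
have xE r (x : 'rV[R]_n) : xsection (E r) x = (fun y : 'rV[R]_n => (x - y)%R) @^-1` A r.
  by apply/seteqP; split => y; rewrite /xsection/= inE.
have Eoo r x : mu (xsection (E r) x) < +oo.
  rewrite xE lebesgue_RdE; last by rewrite -[X in measurable X]setTI; exact: measurable_refl_rV.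
  by rewrite lebesgue_borel_refl// -lebesgue_RdE.
(* Precision eta / c for each level set gives eta for their weighted sum. *)
pose c : R := (1 + \sum_(r <- s) r)%R.
have c0 : (0 < c)%R.
  by rewrite ltr_pwDl// big_seq sumr_ge0// => r /s_ge0.
have [Z [mZ Zd Zs]] := @sections_split_seq _ _ _ _ _ mu K mK mu _ s E
  (fun r => sections_split_sigma_finite mK Koo (mE r) (Eoo r))
  (eta / c)%R delta (divr_gt0 eta0 c0) delta0.
exists Z; split => //; apply: finitely_split_sub Zs => // x x' _ _ small.
pose D r := symdiff (xsection (E r) x) (xsection (E r) x').
have mD r : measurable (D r) by apply: measurable_symdiff; exact: measurable_xsection.
apply: (@le_trans _ _ (\int[mu]_z \sum_(r <- s) (if r \in s then r * \1_(D r) z else 0)%:E)).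
  apply: ge0_le_integral_lower => // z; rewrite sumEFin lee_fin !wE -sumrB.
  apply: le_trans (ler_norm_sum _ _ _) _.
  rewrite [leLHS]big_seq [leRHS]big_seq; apply: ler_sum => r rs; rewrite rs.
  rewrite -(mulrBr r) normrM (@ger0_norm _ r) ?s_ge0//.
  have [->|r0] := eqVneq r 0%R; first by rewrite !mul0r.
  rewrite ler_wpM2l ?s_ge0// !indicE /D !xE /A (negbTE r0).
  have memE (a : 'rV[R]_n) : (a \in w @^-1` [set r]) = (w a == r).
    by apply/idP/eqP; rewrite inE.
  rewrite !memE; set b := w (x - _)%R == r; set b' := w (x' - _)%R == r.
  rewrite (_ : (z \in symdiff _ _) = (b != b')); last first.
    apply/idP/idP; rewrite inE /symdiff /=.
      by move=> [[/eqP h1 /eqP h2]|[/eqP h1 /eqP h2]]; rewrite /b /b' h1 (negbTE h2).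
    have [h1|h1] := eqVneq (w (x - z)%R) r; have [h2|h2] := eqVneq (w (x' - z)%R) r => //=.
    - by rewrite /b /b' h1 h2 eqxx.
    - by move=> _; left; split => //; exact/eqP.
    - by move=> _; right; split => //; exact/eqP.
    - by rewrite /b /b' (negbTE h1) (negbTE h2).
  by case: b; case: b'; rewrite ?subrr ?normr0 ?subr0 ?sub0r ?normrN ?normr1.
have m1 r : measurable_fun setT (fun z : Rd R n => (\1_(D r) z : R)%:E).
  by apply/measurable_EFinP; exact: measurable_indic.
have mterm r : measurable_fun setT (fun z : Rd R n => (if r \in s then r * \1_(D r) z else 0)%:E).
  have [_|_] := boolP (r \in s); last exact: measurable_cst.
  under eq_fun do rewrite EFinM.
  by apply: measurable_funeM; exact: m1.
have term0 r (z : Rd R n) : setT z -> 0 <= (if r \in s then r * \1_(D r) z else 0)%:E.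
  by move=> _; case: ifPn => [/s_ge0 r0|//]; rewrite lee_fin mulr_ge0.
rewrite (ge0_integral_sum mu measurableT mterm term0).
apply: (@le_trans _ _ (\sum_(r <- s) (if r \in s then r * (eta / c) else 0)%:E)).
  rewrite [leLHS]big_seq [leRHS]big_seq; apply: lee_sum => r rs; rewrite rs.
  under eq_integral do rewrite EFinM.
  rewrite (ge0_integralZl mu measurableT (m1 r)); last 2 first.
  - by move=> y _; rewrite lee_fin.
  - by rewrite lee_fin s_ge0.
  rewrite (integral_indic mu measurableT (mD r)) setIT EFinM lee_wpmul2l ?lee_fin ?s_ge0//.
  exact: small.
rewrite sumEFin lee_fin.
have -> : (\sum_(i <- s) (if i \in s then i * (eta / c) else 0) = (\sum_(i <- s) i) * (eta / c))%R.
  by rewrite big_seq [in RHS]big_seq big_distrl/=; apply: eq_bigr => r ->.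
rewrite mulrCA ler_piMr ?(ltW eta0)// ler_pdivrMr// mul1r.
by rewrite /c lerDr.
Qed.

End convolution_kernel.

(** * Averages against a weight *)

Section young_averaging.
Context d (T : measurableType d) (R : realType) (mu : {measure set T -> \bar R}).
Variables (p : R).
Hypothesis p1 : 1 <= p.

Let p0 : 0 < p. Proof. exact: lt_le_trans p1. Qed.

(** If a > t, then a = a^p a^(1-p) <= a^p t^(1-p).  Integrated against a
    weight, with t adapted to the integrals, it plays the role of Hoelder's inequality. *)
Lemma young_le (a t : R) : 0 <= a -> 0 < t -> a <= t + t `^ (1 - p) * a `^ p.
Proof.
move=> a0 t0; have [at_|ta] := leP a t.
  by rewrite (le_trans at_)// lerDl mulr_ge0// powR_ge0.
apply: (@le_trans _ _ (t `^ (1 - p) * a `^ p)); last by rewrite lerDr ltW.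
rewrite -(mulr_powRB1 a0 p0) mulrCA ler_peMr// -opprB powRN ler_pdivlMl ?powR_gt0// mulr1.
by apply: ge0_ler_powR; rewrite ?nnegrE ?subr_ge0// ltW.
Qed.

Lemma integral_young (f q : T -> R) (t : R) :
  measurable_fun setT f -> measurable_fun setT q -> (forall y, 0 <= q y) -> 0 < t ->
  (\int[mu]_y (`|f y| * q y)%:E <=
   t%:E * \int[mu]_y (q y)%:E + (t `^ (1 - p))%:E * \int[mu]_y (`|f y| `^ p * q y)%:E)%E.
Proof.
move=> mf mq q0 t0.
have mfp : measurable_fun setT (fun y => (`|f y| `^ p * q y)%:E).
  apply/measurable_EFinP; apply: measurable_funM => //.
  exact/measurable_EFinP/measurable_powR_norm.
rewrite -ge0_integralZl//; last 3 first.
- exact/measurable_EFinP.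
- by move=> y _; rewrite lee_fin.
- by rewrite lee_fin ltW.
rewrite -ge0_integralZl//; last 2 first.
- by move=> y _; rewrite lee_fin mulr_ge0// powR_ge0.
- by rewrite lee_fin powR_ge0.
rewrite -ge0_integralD//; last 4 first.
- by move=> y _; rewrite -EFinM lee_fin mulr_ge0// ltW.
- by apply: measurable_funeM; exact/measurable_EFinP.
- by move=> y _; rewrite -EFinM lee_fin !mulr_ge0// powR_ge0.
- exact: measurable_funeM.
apply: ge0_le_integral_lower => y; first by rewrite lee_fin mulr_ge0.
rewrite -!EFinM -EFinD lee_fin mulrA -mulrDl ler_wpM2r//; exact: young_le.
Qed.

(** The choice t = (g / r)^(1/p) balances the two terms.  For g = 0, let t tend to 0. *)
Lemma integral_young_opt (f q : T -> R) (r g : R) :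
  measurable_fun setT f -> measurable_fun setT q -> (forall y, 0 <= q y) -> 0 < r ->
  (\int[mu]_y (q y)%:E = r%:E)%E -> (\int[mu]_y (`|f y| `^ p * q y)%:E = g%:E)%E ->
  (\int[mu]_y (`|f y| * q y)%:E <= (2 * r * (g / r) `^ p^-1)%:E)%E.
Proof.
move=> mf mq q0 r0 qr fg.
have g0 : 0 <= g.
  by rewrite -lee_fin -fg; apply: integral_ge0 => y _; rewrite lee_fin mulr_ge0// powR_ge0.
move: g0; rewrite le_eqVlt => /predU1P[g0|g0].
  rewrite -g0 mul0r powR0 ?invr_eq0 ?gt_eqF// mulr0.
  apply/lee_addgt0Pr => e e0; rewrite add0e.
  apply: le_trans (integral_young mf mq q0 (divr_gt0 e0 r0)) _.
  by rewrite qr fg -g0 mule0 adde0 -EFinM lee_fin divfK// gt_eqF.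
pose t := (g / r) `^ p^-1.
have t0 : 0 < t by rewrite powR_gt0// divr_gt0.
have tp : t `^ p = g / r.
  by rewrite /t -powRrM mulVf ?gt_eqF// powRr1// divr_ge0// ltW.
apply: le_trans (integral_young mf mq q0 t0) _.
rewrite qr fg -!EFinM -EFinD lee_fin -/t powRB; last by rewrite (gt_eqF t0) implybT.
rewrite (powRr1 (ltW t0)) tp.
by rewrite le_eqVlt; apply/orP; left; apply/eqP; field; rewrite !gt_eqF.
Qed.

(** Write r a as the integral of (a - f) q plus that of f q.  The first one is
    estimated by the Young inequality, with a weight q of total mass r. *)
Lemma average_bound (f q : T -> R) (a r : R) :
  measurable_fun setT f -> measurable_fun setT q -> (forall y, 0 <= q y) -> 0 < r ->
  (\int[mu]_y (q y)%:E = r%:E)%E -> mu.-integrable setT (fun y => (f y * q y)%:E) ->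
  ((`|a| `^ p)%:E <= (4 `^ p / r)%:E * \int[mu]_y (`|a - f y| `^ p * q y)%:E +
     (2 `^ p / r `^ p * `|\int[mu]_y (f y * q y)| `^ p)%:E)%E.
Proof.
move=> mf mq q0 r0 qr ifq.
set G := (\int[mu]_y (`|a - f y| `^ p * q y)%:E)%E; set Tf := \int[mu]_y (f y * q y).
have G0 : (0 <= G)%E by apply: integral_ge0 => y _; rewrite lee_fin mulr_ge0// powR_ge0.
case: (boolP (G == +oo%E)) => [/eqP->|Goo].
  by rewrite gt0_muley ?lte_fin ?divr_gt0 ?powR_gt0// addye ?leey.
have Gf : G \is a fin_num by rewrite fin_numE Goo andbT gt_eqF// (lt_le_trans _ G0)// ltNy0.
have maf : measurable_fun setT (fun y => a - f y) by exact: measurable_funB.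
(* An infinite right-hand side having been excluded, all integrals are real. *)
have opt := integral_young_opt maf mq q0 r0 qr (esym (fineK Gf)).
set A := 2 * r * (fine G / r) `^ p^-1 in opt.
have iq : mu.-integrable setT (fun y => (q y)%:E).
  apply/integrableP; split; first exact/measurable_EFinP.
  under eq_integral do rewrite gee0_abs ?lee_fin//.
  by rewrite qr ltry.
have iaq : mu.-integrable setT (fun y => (a * q y)%:E).
  by under eq_fun do rewrite EFinM; exact: integrableZl.
have key : `|a| * r <= A + `|Tf|.
  have -> : `|a| * r = `|\int[mu]_y (a * q y)|.
    rewrite RintegralZl// normrM; congr (_ * _).
    by rewrite /Rintegral qr /= gtr0_norm.
  have -> : \int[mu]_y (a * q y) = \int[mu]_y (a * q y - f y * q y) + Tf.
    by rewrite RintegralB//= subrK.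
  apply: le_trans (ler_normD _ _) _; rewrite lerD2r.
  have idiff : mu.-integrable setT (fun y => (a * q y - f y * q y)%:E).
    by under eq_fun do rewrite EFinB; exact: integrableB.
  apply: le_trans (le_normr_Rintegral _ _) _ => //.
  rewrite -lee_fin /Rintegral fineK; last first.
    apply: integrable_fin_num => //; exact: (integrable_norm idiff).
  apply: le_trans _ opt; apply: ge0_le_integral_lower => y; rewrite lee_fin//.
  by rewrite -mulrBl normrM (ger0_norm (q0 y)).
have fG0 : 0 <= fine G by exact: fine_ge0.
rewrite -(fineK Gf) -EFinM -EFinD lee_fin.
have ar : `|a| <= 2 * (fine G / r) `^ p^-1 + `|Tf| / r.
  rewrite -(ler_pM2r r0) mulrDl divfK ?gt_eqF//.
  have <- : A = 2 * (fine G / r) `^ p^-1 * r by rewrite /A; ring.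
  exact: key.
have lhs0 : 0 <= 2 * (fine G / r) `^ p^-1 by rewrite mulr_ge0// powR_ge0.
have rhs0 : 0 <= `|Tf| / r by rewrite divr_ge0// ltW.
apply: (@le_trans _ _ (`|2 * (fine G / r) `^ p^-1 + `|Tf| / r| `^ p)).
  by apply: ge0_ler_powR; rewrite ?nnegrE ?(ltW p0)//; exact: le_trans ar (ler_norm _).
apply: le_trans (powR_normD _ _ (ltW p0)) _.
rewrite (ger0_norm lhs0) (ger0_norm rhs0).
rewrite powRM ?powR_ge0// -powRrM mulVf ?gt_eqF// powRr1; last by rewrite divr_ge0// ltW.
rewrite (_ : 4 = 2 * 2 :> R); last by ring.
rewrite [(2 * 2) `^ p]powRM// powRM ?invr_ge0 ?(ltW r0)//.
have -> : r^-1 `^ p = (r `^ p)^-1.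
  by rewrite -powR_inv1 ?(ltW r0)// -powRrM mulN1r powRN.
by rewrite le_eqVlt; apply/orP; left; apply/eqP; ring.
Qed.

End young_averaging.

Section weighted_integrals.
Context d (T : measurableType d) (R : realType) (mu : {measure set T -> \bar R}).
Variables (p : R) (p1 : 1 <= p) (f q : T -> R) (C Q eta : R).
Hypotheses (mf : measurable_fun setT f) (mq : measurable_fun setT q).
Hypotheses (q0 : forall y, 0 <= q y) (qC : forall y, q y <= C).
Hypothesis qeta : (\int[mu]_y (q y)%:E <= eta%:E)%E.
Hypothesis fQ : (\int[mu]_y (`|f y| `^ p)%:E <= Q%:E)%E.
Hypothesis C0 : 0 <= C.

(** The parameter t allows eta to be small compared with a fixed bound Q for the p-th
    moment: t is chosen large first, then eta small depending on t. *)
Lemma weighted_integral_le t : 0 < t ->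
  (\int[mu]_y (`|f y| * q y)%:E <= (t * eta + t `^ (1 - p) * (C * Q))%:E)%E.
Proof.
move=> t0; apply: le_trans (integral_young mu p1 mf mq q0 t0) _.
rewrite EFinD; apply: leeD.
  by rewrite EFinM lee_wpmul2l// lee_fin ltW.
rewrite EFinM lee_wpmul2l// ?lee_fin ?powR_ge0//.
apply: (@le_trans _ _ (C%:E * \int[mu]_y (`|f y| `^ p)%:E)%E); last first.
  by rewrite EFinM lee_wpmul2l// lee_fin.
have mfp : measurable_fun setT (fun y => (`|f y| `^ p)%:E) by exact: measurable_powR_norm.
rewrite -(ge0_integralZl mu measurableT mfp); last 2 first.
- by move=> y _; rewrite lee_fin powR_ge0.
- by rewrite lee_fin.
apply: ge0_le_integral_lower => y; rewrite -?EFinM lee_fin.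
  by rewrite mulr_ge0// powR_ge0.
by rewrite mulrC ler_wpM2r// powR_ge0.
Qed.

Variable g : T -> R.
Hypotheses (mg : measurable_fun setT g) (gfq : forall y, `|g y| <= `|f y| * q y).

Lemma integrable_weighted : mu.-integrable setT (fun y => (g y)%:E).
Proof.
apply/integrableP; split; first exact/measurable_EFinP.
apply: le_lt_trans (_ : _ <= (1 * eta + 1 `^ (1 - p) * (C * Q))%:E)%E _; last exact: ltry.
apply: le_trans _ (weighted_integral_le ltr01).
by apply: ge0_le_integral_lower => y /=; rewrite lee_fin.
Qed.

Lemma normr_weighted_le t : 0 < t ->
  `|\int[mu]_y g y| <= t * eta + t `^ (1 - p) * (C * Q).
Proof.
move=> t0; apply: le_trans (le_normr_Rintegral _ integrable_weighted) _ => //.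
rewrite -lee_fin /Rintegral fineK; last first.
  by apply: integrable_fin_num => //; exact: (integrable_norm integrable_weighted).
apply: le_trans _ (weighted_integral_le t0).
by apply: ge0_le_integral_lower => y; rewrite lee_fin.
Qed.

End weighted_integrals.

Lemma ge0_integralZD dT (T : measurableType dT) (R : realType)
    (mu : {measure set T -> \bar R}) (k : R) (f g : T -> \bar R) : 0 <= k ->
  measurable_fun setT f -> measurable_fun setT g ->
  (forall x, 0 <= f x)%E -> (forall x, 0 <= g x)%E ->
  (\int[mu]_x (k%:E * (f x + g x)) = k%:E * (\int[mu]_x f x + \int[mu]_x g x))%E.
Proof.
move=> k0 mf mg f0 g0; rewrite ge0_integralZl//; last 2 first.
- exact: emeasurable_funD.
- by move=> x _; rewrite adde_ge0.
by rewrite ge0_integralD.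
Qed.

Section weighted_averages.
Context (R : realType) (d : nat) (p : R) (p1 : 1 <= p).
Local Notation mu := (@lebesgue_Rd R d).
Variable (w : borel_rV R d -> R).
Hypotheses (mw : measurable_fun setT w) (w0 : forall h, 0 <= w h).

Let p0 : 0 < p. Proof. exact: lt_le_trans p1. Qed.

Lemma measurable_kernel_row (x : 'rV[R]_d) :
  measurable_fun setT (fun y : Rd R d => w (x - (y : 'rV[R]_d))).
Proof. by apply: measurable_fun_Rd; exact: (measurableT_comp mw (measurable_refl_rV x)). Qed.

Lemma measurable_kernel :
  measurable_fun setT (fun z : Rd R d * Rd R d => w ((z.1 : 'rV[R]_d) - (z.2 : 'rV[R]_d))).
Proof. exact: (measurableT_comp mw (@measurable_sub_Rd R d)). Qed.

Lemma integral_kernel_row (x : 'rV[R]_d) :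
  (\int[mu]_y (w (x - (y : 'rV[R]_d)))%:E = \int[mu]_h (w h)%:E)%E.
Proof.
apply: (@ge0_integral_refl _ _ (fun h => (w h)%:E)); first exact/measurable_EFinP.
by move=> z; rewrite lee_fin.
Qed.

Definition weighted_energy (f : Rd R d -> R) (x : 'rV[R]_d) : \bar R :=
  (\int[mu]_y (`|f x - f y| `^ p * w (x - (y : 'rV[R]_d)))%:E)%E.

Lemma measurable_energy_integrand (f : Rd R d -> R) : measurable_fun setT f ->
  measurable_fun setT (fun z : Rd R d * Rd R d =>
    (`|f z.1 - f z.2| `^ p * w ((z.1 : 'rV[R]_d) - (z.2 : 'rV[R]_d)))%:E).
Proof.
move=> mf; apply/measurable_EFinP; apply: measurable_funM; last exact: measurable_kernel.
apply/measurable_EFinP; apply: (@measurable_powR_norm _ _ _ p (fun z : Rd R d * Rd R d => f z.1 - f z.2)).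
by apply: measurable_funB; [exact: (measurableT_comp mf measurable_fst)
  |exact: (measurableT_comp mf measurable_snd)].
Qed.

Lemma weighted_energy_ge0 f x : (0 <= weighted_energy f x)%E.
Proof. by apply: integral_ge0 => y _; rewrite lee_fin mulr_ge0 ?powR_ge0. Qed.

Lemma measurable_weighted_energy (f : Rd R d -> R) : measurable_fun setT f ->
  measurable_fun setT (weighted_energy f : Rd R d -> \bar R).
Proof.
move=> mf; have F0 (z : Rd R d * Rd R d) :
    (0 <= (`|f z.1 - f z.2| `^ p * w ((z.1 : 'rV[R]_d) - (z.2 : 'rV[R]_d)))%:E)%E.
  by rewrite lee_fin mulr_ge0 ?powR_ge0.
exact: (@measurable_fun_fubini_tonelli_F _ _ _ _ _ mu _ (measurable_energy_integrand mf) F0).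
Qed.

Lemma weighted_energyB (u v : Rd R d -> R) :
  measurable_fun setT u -> measurable_fun setT v ->
  (\int[mu]_x weighted_energy (fun x => (u x - v x)%R) x <=
   (2 `^ p)%:E * (\int[mu]_x weighted_energy u x + \int[mu]_x weighted_energy v x))%E.
Proof.
move=> mu_ mv.
have mE (g : Rd R d -> R) (x : 'rV[R]_d) : measurable_fun setT g ->
    measurable_fun setT (fun y : Rd R d => (`|g x - g y| `^ p * w (x - (y : 'rV[R]_d)))%:E).
  move=> mg; apply/measurable_EFinP; apply: measurable_funM; last exact: measurable_kernel_row.
  apply/measurable_EFinP; apply: (@measurable_powR_norm _ _ _ p (fun y => g x - g y)).
  by apply: measurable_funB.
have e0 (g : Rd R d -> R) (x y : 'rV[R]_d) : (0 <= (`|g x - g y| `^ p * w (x - y))%:E)%E.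
  by rewrite lee_fin mulr_ge0 ?powR_ge0.
have k0 : 0 <= 2 `^ p :> R by exact: powR_ge0.
rewrite -(ge0_integralZD mu k0 (measurable_weighted_energy mu_)
  (measurable_weighted_energy mv) (weighted_energy_ge0 u) (weighted_energy_ge0 v)).
apply: ge0_le_integral_lower => x; first exact: weighted_energy_ge0.
rewrite /weighted_energy -(ge0_integralZD mu k0 (mE u x mu_) (mE v x mv) (e0 u x) (e0 v x)).
apply: ge0_le_integral_lower => y; first by rewrite lee_fin mulr_ge0 ?powR_ge0.
rewrite -EFinD -EFinM lee_fin -mulrDl mulrA ler_wpM2r//.
rewrite (_ : u x - v x - (u y - v y) = (u x - u y) - (v x - v y)); last by ring.
exact: powR_normB (ltW p0).
Qed.

(** On the diagonal both integrands vanish, and off the diagonal w <= nu. *)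
Lemma weighted_energy_le (nu : Rd R d -> R) (f : Rd R d -> R) :
  (forall h : 'rV[R]_d, h != 0 -> w h <= nu h) ->
  (\int[mu]_x weighted_energy f x <= nonlocal_energy p nu f)%E.
Proof.
move=> wnu; apply: ge0_le_integral_lower => x; first exact: weighted_energy_ge0.
apply: ge0_le_integral_lower => y; rewrite lee_fin; first by rewrite mulr_ge0 ?powR_ge0.
have [->|xy] := eqVneq (x : 'rV[R]_d) y.
  by rewrite !subrr normr0 powR0 ?mul0r// gt_eqF.
by rewrite ler_wpM2l ?powR_ge0// wnu// subr_eq0.
Qed.

End weighted_averages.

Lemma ge0_integral_three_terms dT (T : measurableType dT) (R : realType)
    (mu : {measure set T -> \bar R}) (k a b : R) (g : T -> \bar R) (A B : set T) :
  0 <= k -> 0 <= a -> 0 <= b -> measurable_fun setT g -> (forall x, 0 <= g x)%E ->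
  measurable A -> measurable B ->
  (\int[mu]_x (k%:E * g x + (a * \1_A x + b * \1_B x)%:E) =
   k%:E * \int[mu]_x g x + (a%:E * mu A + b%:E * mu B))%E.
Proof.
move=> k0 a0 b0 mg g0 mA mB.
have mind c (D : set T) : measurable D -> measurable_fun setT (fun x => (c * \1_D x : R)%:E).
  by move=> mD; apply/measurable_EFinP; apply: measurable_funM.
have ind0 c (D : set T) (x : T) : 0 <= c -> (0 <= (c * \1_D x : R)%:E)%E.
  by move=> c0; rewrite lee_fin mulr_ge0.
have iind c (D : set T) : 0 <= c -> measurable D -> (\int[mu]_x (c * \1_D x)%:E = c%:E * mu D)%E.
  move=> c0 mD; under eq_integral do rewrite EFinM.
  have m1 : measurable_fun setT (fun x => (\1_D x : R)%:E) by apply/measurable_EFinP.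
  rewrite (ge0_integralZl mu measurableT m1).
  - by rewrite integral_indic// setIT.
  - by move=> x _; rewrite lee_fin.
  - by rewrite lee_fin.
under eq_integral do rewrite EFinD.
rewrite ge0_integralD//; last 4 first.
- by move=> x _; rewrite mule_ge0// lee_fin.
- exact: measurable_funeM.
- by move=> x _; rewrite adde_ge0// ind0.
- by apply: emeasurable_funD; exact: mind.
rewrite ge0_integralZl ?lee_fin//; congr (_ + _)%E.
rewrite ge0_integralD//; last 4 first.
- by move=> x _; exact: ind0.
- exact: mind.
- by move=> x _; exact: ind0.
- exact: mind.
by rewrite !iind.
Qed.

Section smear.
Context (R : realType) (d : nat) (p : R) (p1 : 1 <= p).
Local Notation mu := (@lebesgue_Rd R d).
Variables (w : borel_rV R d -> R) (C I : R).
Hypotheses (mw : measurable_fun setT w) (w0 : forall h, 0 <= w h) (wC : forall h, w h <= C).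
Hypotheses (I0 : 0 < I) (wI : (\int[mu]_h (w h)%:E = I%:E)%E).

Let p0 : 0 < p. Proof. exact: lt_le_trans p1. Qed.
Let C0 : 0 <= C. Proof. exact: le_trans (w0 0) (wC 0). Qed.

(** The convolution of f with w. *)
Definition smear (f : Rd R d -> R) (x : 'rV[R]_d) : R :=
  \int[mu]_y (f y * w (x - (y : 'rV[R]_d))).

Lemma measurable_smear_integrand (f : Rd R d -> R) (x : 'rV[R]_d) : measurable_fun setT f ->
  measurable_fun setT (fun y : Rd R d => f y * w (x - (y : 'rV[R]_d))).
Proof. move=> mf; exact: (measurable_funM mf (measurable_kernel_row mw x)). Qed.

Lemma kernel_row_I (x : 'rV[R]_d) : (\int[mu]_y (w (x - (y : 'rV[R]_d)))%:E = I%:E)%E.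
Proof. by rewrite integral_kernel_row. Qed.

Section one_function.
Variables (f : Rd R d -> R) (Q : R).
Hypotheses (mf : measurable_fun setT f) (fQ : (\int[mu]_y (`|f y| `^ p)%:E <= Q%:E)%E).

Lemma integrable_smear (x : 'rV[R]_d) :
  mu.-integrable setT (fun y : Rd R d => (f y * w (x - (y : 'rV[R]_d)))%:E).
Proof.
have row := kernel_row_I x.
have bnd y : `|f y * w (x - (y : 'rV[R]_d))| <= `|f y| * w (x - (y : 'rV[R]_d)).
  by rewrite normrM (ger0_norm (w0 _)).
have rowI : (\int[mu]_y (w (x - (y : 'rV[R]_d)))%:E <= I%:E)%E by rewrite row.
exact: (integrable_weighted p1 mf (measurable_kernel_row mw x) (fun y => w0 _)
  (fun y => wC _) rowI fQ C0 (measurable_smear_integrand x mf) bnd).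
Qed.

Lemma smear_le (x : 'rV[R]_d) : `|smear f x| <= I + C * Q.
Proof.
have bnd y : `|f y * w (x - (y : 'rV[R]_d))| <= `|f y| * w (x - (y : 'rV[R]_d)).
  by rewrite normrM (ger0_norm (w0 _)).
have rowI : (\int[mu]_y (w (x - (y : 'rV[R]_d)))%:E <= I%:E)%E by rewrite kernel_row_I.
have := normr_weighted_le p1 mf (measurable_kernel_row mw x) (fun y => w0 _)
  (fun y => wC _) rowI fQ C0 (measurable_smear_integrand x mf) bnd ltr01.
by rewrite powR1 !mul1r.
Qed.

Lemma smear_dist_le (x x' : 'rV[R]_d) (eta t : R) : 0 < t ->
  (\int[mu]_z `|w (x - (z : 'rV[R]_d))%R - w (x' - (z : 'rV[R]_d))%R|%:E <= eta%:E)%E ->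
  `|smear f x - smear f x'| <= t * eta + t `^ (1 - p) * (C * Q).
Proof.
move=> t0 xx'; rewrite /smear -RintegralB//; [|exact: integrable_smear|exact: integrable_smear].
pose q (y : Rd R d) := `|w (x - (y : 'rV[R]_d)) - w (x' - (y : 'rV[R]_d))|.
have mq : measurable_fun setT q.
  have := measurable_funB (measurable_kernel_row mw x) (measurable_kernel_row mw x').
  exact: (measurableT_comp (@normr_measurable R setT)).
have q0 y : 0 <= q y by exact: normr_ge0.
have qC y : q y <= C.
  rewrite /q ler_norml; have := w0 (x - y); have := w0 (x' - y).
  have := wC (x - y); have := wC (x' - y) => ? ? ? ?.
  by apply/andP; split; lra.
have mg : measurable_fun setT (fun y : Rd R d => f y * w (x - (y : 'rV[R]_d)) -
    f y * w (x' - (y : 'rV[R]_d))).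
  exact: (measurable_funB (measurable_smear_integrand x mf) (measurable_smear_integrand x' mf)).
apply: (normr_weighted_le p1 mf mq q0 qC xx' fQ C0 mg _ t0).
by move=> y; rewrite -mulrBr normrM.
Qed.

Lemma pointwise_smear_bound (x : 'rV[R]_d) :
  ((`|f x| `^ p)%:E <= (4 `^ p / I)%:E * weighted_energy p w f x +
     (2 `^ p / I `^ p * `|smear f x| `^ p)%:E)%E.
Proof.
exact: (average_bound p1 (f x) mf (measurable_kernel_row mw x) (fun y => w0 _) I0
  (kernel_row_I x) (integrable_smear x)).
Qed.

(** On K the pointwise bound is used with the small bound tau for the average,
    except on the exceptional set Z, where the trivial bound B is enough since Z is
    small. *)
Lemma integral_smear_bound (K Z : set (Rd R d)) (B tau delta kappa : R) :
  measurable K -> measurable Z -> 0 <= B -> 0 <= tau ->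
  (mu (K `&` Z) <= delta%:E)%E -> (mu K <= kappa%:E)%E ->
  (forall x, `|smear f x| <= B) -> (forall x, (K `\` Z) x -> `|smear f x| <= tau) ->
  (\int[mu]_(x in K) (`|f x| `^ p)%:E <=
    (4 `^ p / I)%:E * \int[mu]_x weighted_energy p w f x +
    (2 `^ p / I `^ p * (B `^ p * delta + tau `^ p * kappa))%:E)%E.
Proof.
move=> mK mZ B0 tau0 Zd Kk fB ftau.
set k := 4 `^ p / I; set c := 2 `^ p / I `^ p.
have k0 : 0 <= k by rewrite divr_ge0 ?powR_ge0// ltW.
have c0 : 0 <= c by rewrite divr_ge0 ?powR_ge0.
have a0 : 0 <= c * B `^ p by rewrite mulr_ge0 ?powR_ge0.
have b0 : 0 <= c * tau `^ p by rewrite mulr_ge0 ?powR_ge0.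
have mE := measurable_weighted_energy p mw w0 mf.
have E0 x := weighted_energy_ge0 p w0 f x.
have mKZ : measurable (K `&` Z) by exact: measurableI.
rewrite integral_mkcond.
apply: (@le_trans _ _ (\int[mu]_x (k%:E * weighted_energy p w f x +
   ((c * B `^ p) * \1_(K `&` Z) x + (c * tau `^ p) * \1_K x)%:E))%E); last first.
  rewrite (ge0_integral_three_terms mu k0 a0 b0 mE E0 mKZ mK) leeD2l//.
  rewrite mulrDr EFinD; apply: leeD.
    by rewrite (mulrA c) [leRHS]EFinM lee_wpmul2l.
  by rewrite (mulrA c) [leRHS]EFinM lee_wpmul2l.
apply: ge0_le_integral_lower => x; rewrite patchE.
  by case: ifPn => _; rewrite ?lee_fin ?powR_ge0.
have rest0 : 0 <= (c * B `^ p) * \1_(K `&` Z) x + (c * tau `^ p) * \1_K x.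
  by apply: addr_ge0; (apply: mulr_ge0; first by []); rewrite indicE ler0n.
case: ifPn => [/set_mem Kx|_]; last by rewrite adde_ge0 ?mule_ge0 ?lee_fin.
apply: le_trans (pointwise_smear_bound x) _; rewrite leeD2l// lee_fin.
have K1 : \1_K x = 1 :> R by rewrite indicE mem_set.
rewrite -[2 `^ p / I `^ p]/c K1 mulr1.
have [Zx|nZx] := pselect (Z x).
  have KZ1 : \1_(K `&` Z) x = 1 :> R by rewrite indicE mem_set.
  rewrite KZ1 mulr1 -[leLHS]addr0 lerD// ler_wpM2l//.
  by apply: ge0_ler_powR; rewrite ?nnegrE ?(ltW p0).
rewrite -[leLHS]add0r lerD//; first by rewrite mulr_ge0// indicE ler0n.
rewrite ler_wpM2l//; apply: ge0_ler_powR; rewrite ?nnegrE ?(ltW p0)//.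
exact: ftau.
Qed.

End one_function.

Lemma smearB (u v : Rd R d -> R) (Q : R) (x : 'rV[R]_d) :
  measurable_fun setT u -> measurable_fun setT v ->
  (\int[mu]_y (`|u y| `^ p)%:E <= Q%:E)%E -> (\int[mu]_y (`|v y| `^ p)%:E <= Q%:E)%E ->
  smear (fun y => u y - v y) x = smear u x - smear v x.
Proof.
move=> mu_ mv uQ vQ; rewrite /smear -RintegralB//.
- by apply: eq_Rintegral => y _; rewrite mulrBl.
- exact: integrable_smear uQ x.
- exact: integrable_smear vQ x.
Qed.

End smear.

Section Sobolev_norm_bounds.
Context (R : realType) (d : nat) (p : R) (p1 : (1 <= p%:E)%E) (nu : Rd R d -> R).
Local Notation mu := (@lebesgue_Rd R d).
Hypothesis nu_ge0 : forall h : 'rV[R]_d, h != 0 -> 0 <= nu h.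

Let p0 : 0 < p. Proof. by rewrite (lt_le_trans ltr01)// -lee_fin. Qed.

(** On the diagonal nu (0), of unknown sign, is multiplied by 0. *)
Lemma energy_integrand_ge0 (f : Rd R d -> R) (x y : 'rV[R]_d) :
  0 <= `|f x - f y| `^ p * nu (x - y).
Proof.
have [->|xy] := eqVneq x y; first by rewrite !subrr normr0 powR0 ?mul0r// gt_eqF.
by rewrite mulr_ge0 ?powR_ge0// nu_ge0// subr_eq0.
Qed.

Lemma nonlocal_energy_ge0 (f : Rd R d -> R) : (0 <= nonlocal_energy p nu f)%E.
Proof.
apply: integral_ge0 => x _; apply: integral_ge0 => y _; rewrite lee_fin.
exact: energy_integrand_ge0.
Qed.

Lemma W_normP (u : LspaceType mu p1) (M : R) : 0 <= M ->
  (W_norm nu u <= M%:E)%E <->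
  (\int[mu]_x (`|(u x : R)| `^ p)%:E + nonlocal_energy p nu u <= (M `^ p)%:E)%E.
Proof.
move=> M0; rewrite /W_norm Lnorm_powR//; set X := (_ + _)%E.
have X0 : (0 <= X)%E.
  by rewrite adde_ge0 ?nonlocal_energy_ge0// integral_ge0.
split=> h.
  have -> : X = ((X `^ p^-1) `^ p)%E by rewrite -poweRrM mulVf ?gt_eqF// poweRe1.
  rewrite -poweR_EFin; apply: gt0_ler_poweR => //; rewrite ?(ltW p0)//.
  - by rewrite in_itv/= leey poweR_ge0.
  - by rewrite in_itv/= leey lee_fin M0.
have -> : M%:E = ((M `^ p)%:E `^ p^-1)%E by rewrite poweR_EFin -powRrM divff ?gt_eqF// powRr1.
apply: gt0_ler_poweR => //; first by rewrite invr_ge0 ltW.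
- by rewrite in_itv/= leey X0.
- by rewrite in_itv/= leey lee_fin powR_ge0.
Qed.

Lemma W_norm_bounds (u : LspaceType mu p1) (M : R) : 0 <= M ->
  (W_norm nu u <= M%:E)%E ->
  (\int[mu]_x (`|(u x : R)| `^ p)%:E <= (M `^ p)%:E)%E /\
  (nonlocal_energy p nu u <= (M `^ p)%:E)%E.
Proof.
move=> M0 /W_normP-/(_ M0) h; split; apply: le_trans h.
  by rewrite leeDl// nonlocal_energy_ge0.
by rewrite leeDr// integral_ge0.
Qed.

End Sobolev_norm_bounds.

(** * Non-integrable kernels give compact embeddings *)

Section borel_minorants.
Context (R : realType) (d : nat) (nu : Rd R d -> R).
Local Notation mu := (@lebesgue_Rd R d).
Hypothesis nu_measurable : measurable_fun (@punctured R d) nu.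
Hypothesis nu_ge0 : forall h : 'rV[R]_d, h != 0 -> 0 <= nu h.

Lemma measurable_punctured : measurable (@punctured R d).
Proof.
rewrite (_ : @punctured R d = ~` ([set 0] : set 'rV[R]_d)); last first.
  by apply/seteqP; split => x /= /eqP.
apply: measurableC; apply: compact_measurable_Rd; exact: compact_set1.
Qed.

(** Setting the Borel representative to 0 on the null set where it may fail gives a
    minorant of nu with the same integral. *)
Lemma borel_version : exists (g : borel_rV R d -> R) (N : set (borel_rV R d)),
  [/\ measurable_fun setT g, forall x, 0 <= g x, measurable N, lebesgue_borel R d N = 0%E &
   [/\ forall h : 'rV[R]_d, h != 0 -> g h <= nu h,
   forall h : 'rV[R]_d, h != 0 -> ~ N h -> g h = nu h &
   (\int[mu]_(h in @punctured R d) (nu h)%:E = \int[mu]_h (g h)%:E)%E]].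
Proof.
pose nu1 := nu \_ (@punctured R d).
have mnu1 : measurable_fun setT nu1.
  exact/(measurable_restrictT _ measurable_punctured).
have [N [mN N0 mN1]] := caratheodory_fun_representative mnu1.
pose g : borel_rV R d -> R := nu1 \_ (~` N).
have mg : measurable_fun setT g by apply/(measurable_restrictT _ (measurableC mN)).
have nu1_ge0 h : 0 <= nu1 h.
  by rewrite /nu1 patchE; case: ifPn => // /set_mem /nu_ge0.
have g0 h : 0 <= g h by rewrite /g patchE; case: ifPn.
have nu1E (h : 'rV[R]_d) : h != 0 -> nu1 h = nu h.
  by move=> h0; rewrite /nu1 patchE mem_set.
exists g, N; split => //; split.
- move=> h h0; rewrite /g patchE; case: ifPn => _; first by rewrite nu1E.
  exact: nu_ge0.
- by move=> h h0 Nh; rewrite /g patchE mem_set// nu1E.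
rewrite integral_mkcond [LHS](_ : _ = \int[mu]_h (nu1 h)%:E)%E; last first.
  by apply: eq_integral => h _; rewrite /nu1 !patchE; case: ifPn.
apply: ge0_ae_eq_integral.
- exact: measurableT.
- exact/measurable_EFinP.
- by apply/measurable_EFinP; exact: measurable_fun_Rd.
- by move=> h _; rewrite lee_fin.
- by move=> h _; rewrite lee_fin.
exists N; split.
- exact: caratheodory_measurable_mu_ext.
- by rewrite -[RHS]N0; exact: lebesgue_RdE.
move=> h /= hN; apply: contrapT => nN; apply: hN => _.
by rewrite /g patchE mem_set.
Qed.

Import HBNNSimple.

(** The integral over the exhausting sets of finite measure tends to infinity, and each
    of these integrals is a supremum over simple functions, which are bounded and
    supported in a set of finite measure. *)
Lemma borel_minorant_large (M : R) :
  ~ mu.-integrable (@punctured R d) (EFin \o nu) ->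
  exists w : {nnsfun borel_rV R d >-> R},
    [/\ forall h : 'rV[R]_d, h != 0 -> w h <= nu h,
        (\int[mu]_h (w h)%:E < +oo)%E & (M%:E < \int[mu]_h (w h)%:E)%E].
Proof.
move=> nint; have [g [N [mg g0 mN N0 [gnu _ gE]]]] := borel_version.
have goo : (\int[lebesgue_borel R d]_h (g h)%:E = +oo)%E.
  rewrite -ge0_integral_Rd//; last exact/measurable_EFinP.
  apply/eqP; rewrite -gE -[_ == _]negbK; apply/negP => fin; apply: nint.
  apply/integrableP; split; first exact/measurable_EFinP.
  rewrite (eq_integral (fun h => (nu h)%:E)); last first.
    by move=> h /set_mem /nu_ge0 ?; rewrite /= ger0_norm.
  by rewrite ltey.
have /sigma_finiteP[F [TF ndF Foo]] := sigma_finiteT (lebesgue_borel R d).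
have mge : measurable_fun setT (fun h => (g h)%:E) by exact/measurable_EFinP.
have cvgF : (\int[lebesgue_borel R d]_(h in F n) (g h)%:E @[n --> \oo] -->
    \int[lebesgue_borel R d]_(h in \bigcup_n F n) (g h)%:E)%E.
  apply: ge0_nondecreasing_set_cvg_integral => //.
  - by move=> i; exact: (Foo i).1.
  - by move=> i; exact: measurable_funTS.
  - by move=> i x _; rewrite lee_fin.
move: cvgF; rewrite -TF goo => /cvgeyPgt/(_ M)[n _ /(_ n (leqnn n)) /= Mn].
move: Mn; rewrite integral_mkcond ge0_integralTE; last first.
  by move=> x; rewrite patchE; case: ifPn => // _; rewrite lee_fin.
move=> /ereal_sup_gt[_ [w wg <-] Mw].
have wle h : w h <= (g \_ (F n)) h.
  by have := wg h; rewrite !patchE; case: ifPn => _; rewrite lee_fin.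
exists w; split.
- move=> h h0; apply: le_trans (wle h) _; rewrite patchE; case: ifPn => _; first exact: gnu.
  exact: nu_ge0.
- rewrite ge0_integral_Rd; last 2 first.
  + exact/measurable_EFinP.
  + by move=> y; rewrite lee_fin.
  have [C [_ /= /(_ (C + 1)) wC]] := simple_bounded w.
  have wC1 h : w h <= C + 1.
    have C1 : C < C + 1 by rewrite ltrDl.
    exact: le_trans (ler_norm _) (wC C1 h I).
  apply: (@le_lt_trans _ _ (\int[lebesgue_borel R d]_(h in F n) (C + 1)%:E)%E).
    rewrite [leRHS]integral_mkcond; apply: ge0_le_integral_lower => h; rewrite ?lee_fin//.
    rewrite patchE; case: ifPn => hF; first by rewrite lee_fin.
    by have := wle h; rewrite patchE (negbTE hF) -lee_fin.
  rewrite [X in (X < _)%E](integral_cst _ (Foo n).1 (C + 1)%:E).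
  have Ffin : lebesgue_borel R d (F n) \is a fin_num by rewrite ge0_fin_numE ?(Foo n).2.
  by rewrite -[X in (_ * X)%E](fineK Ffin) -EFinM ltry.
rewrite ge0_integral_Rd; last 2 first.
- exact/measurable_EFinP.
- by move=> y; rewrite lee_fin.
by rewrite integralT_nnsfun.
Qed.

End borel_minorants.

Section compactness_of_nonintegrable.
Context (R : realType) (d : nat) (p : R) (nu : Rd R d -> R) (p_gt1 : 1 < p).
Local Notation mu := (@lebesgue_Rd R d).
Local Notation LT := (LspaceType mu (gt1_ge1e p_gt1)).
Hypothesis nu_measurable : measurable_fun (@punctured R d) nu.
Hypothesis nu_ge0 : forall h : 'rV[R]_d, h != 0 -> 0 <= nu h.

Let p1 : 1 <= p. Proof. exact: ltW. Qed.
Let p0 : 0 < p. Proof. exact: lt_trans ltr01 p_gt1. Qed.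

Import HBNNSimple.

Lemma integral_powR_normB_le (u v : Rd R d -> R) (A : R) :
  measurable_fun setT u -> measurable_fun setT v ->
  (\int[mu]_y (`|u y| `^ p)%:E <= A%:E)%E -> (\int[mu]_y (`|v y| `^ p)%:E <= A%:E)%E ->
  (\int[mu]_y (`|u y - v y| `^ p)%:E <= (2 `^ p * (A + A))%:E)%E.
Proof.
move=> mu_ mv uA vA.
have k0 : 0 <= 2 `^ p :> R by exact: powR_ge0.
have f0 (g : Rd R d -> R) y : (0 <= (`|g y| `^ p)%:E)%E by rewrite lee_fin powR_ge0.
apply: (@le_trans _ _ (\int[mu]_y ((2 `^ p)%:E * ((`|u y| `^ p)%:E + (`|v y| `^ p)%:E)))%E).
  apply: ge0_le_integral_lower => y; first by rewrite lee_fin powR_ge0.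
  by rewrite -EFinD -EFinM lee_fin powR_normB// ltW.
rewrite (ge0_integralZD mu k0 (measurable_powR_norm p mu_)
  (measurable_powR_norm p mv) (f0 u) (f0 v)).
rewrite [leRHS]EFinM; apply: lee_wpmul2l; first by rewrite lee_fin.
rewrite [leRHS]EFinD; exact: (leeD uA vA).
Qed.

(** Two functions are given the same colour when their averages at the
    representatives of the cells of K agree up to tau / 3.  Inside a cell the
    averages vary by at most 2 tau / 3, so the averages of u - v are at most tau on K
    outside the exceptional set. *)
Lemma bounded_scale_split (w : {nnsfun borel_rV R d >-> R}) (K : set (Rd R d))
    (A I C tau B delta eta t kappa Q : R) :
  0 < I -> (\int[mu]_h (w h)%:E = I%:E)%E -> (forall h, w h <= C) ->
  (forall h : 'rV[R]_d, h != 0 -> w h <= nu h) ->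
  measurable K -> (mu K <= kappa%:E)%E ->
  0 < tau -> 0 < delta -> 0 < eta -> 0 < t ->
  Q = 2 `^ p * (A + A) -> B = I + C * Q -> 0 <= B ->
  t * eta + t `^ (1 - p) * (C * Q) <= tau / 3 + tau / 3 ->
  finitely_split [set u : LT | (\int[mu]_y (`|(u y : R)| `^ p)%:E <= A%:E)%E /\
      (nonlocal_energy p nu u <= A%:E)%E]
    (fun u v => (\int[mu]_(x in K) (`|(u x : R) - v x| `^ p)%:E <=
      (4 `^ p / I * Q + 2 `^ p / I `^ p * (B `^ p * delta + tau `^ p * kappa))%:E)%E).
Proof.
move=> I0 wI wC wnu mK Kk tau0 delta0 eta0 t0 QE BE B0 small.
have three (a : R) : a = a / 3 + (a / 3 + a / 3) by field.
have mw : measurable_fun setT (w : borel_rV R d -> R) by exact: measurable_funPT.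
have w0 h : 0 <= w h by exact: fun_ge0.
have Koo : (mu K < +oo)%E by apply: le_lt_trans Kk _; rewrite ltry.
have woo : (\int[mu]_h (w h)%:E < +oo)%E by rewrite wI ltry.
have [Z [mZ Zd [n [c [cn cr]]]]] := convolution_kernel_split woo mK Koo eta0 delta0.
have ex_rep j : exists y : 'rV[R]_d, (exists x, (K `\` Z) x /\ c x = j) -> (K `\` Z) y /\ c y = j.
  have [[x xP]|nx] := pselect (exists x, (K `\` Z) x /\ c x = j); first by exists x.
  by exists 0.
(* rep j is a point of the cell of colour j, if that cell is not empty. *)
have [rep repP] := choice ex_rep.
set S := [set u : LT | _].
have tau30 : 0 < tau / 3 by rewrite divr_gt0.
have fun_split j : finitely_split S (fun u v => `|smear w u (rep j) - smear w v (rep j)| <= tau / 3).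
  apply: (finitely_split_bounded (B := I + C * A) tau30) => u [uA _].
  exact: (smear_le p1 mw w0 wC wI (measurable_Lspace u) uA).
apply: finitely_split_sub (finitely_split_all n fun_split) => // u v [uA uE] [vA vE] close.
have mu_ := measurable_Lspace u; have mv := measurable_Lspace v.
pose f (x : Rd R d) : R := (u x : R) - v x.
have mf : measurable_fun setT f := measurable_funB mu_ mv.
have fQ : (\int[mu]_y (`|f y| `^ p)%:E <= Q%:E)%E.
  by rewrite QE; exact: integral_powR_normB_le.
have fB x : `|smear w f x| <= B by rewrite BE; exact: (smear_le p1 mw w0 wC wI mf fQ).
have ftau x : (K `\` Z) x -> `|smear w f x| <= tau.
  move=> KZx; set j := c x.
  have [repKZ crep] : (K `\` Z) (rep j) /\ c (rep j) = j by apply: repP; exists x.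
  have jn : (j < n)%N by exact: cn.
  rewrite (_ : smear w f x = smear w f (rep j) + (smear w f x - smear w f (rep j))); last first.
    by rewrite addrC subrK.
  apply: le_trans (ler_normD _ _) _.
  rewrite (three tau).
  apply: lerD.
    rewrite (smearB p1 mw w0 wC wI (rep j) mu_ mv uA vA).
    exact: close.
  apply: le_trans _ small; apply: (smear_dist_le p1 mw w0 wC wI mf fQ t0).
  by apply: cr => //; rewrite crep.
apply: le_trans (integral_smear_bound p1 mw w0 wC I0 wI mf fQ mK mZ B0 (ltW tau0) Zd Kk fB ftau) _.
rewrite EFinD; apply: leeD => //; rewrite [leRHS]EFinM; apply: lee_wpmul2l.
  by rewrite lee_fin divr_ge0 ?powR_ge0// ltW.
apply: le_trans (weighted_energyB p1 mw w0 mu_ mv) _.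
rewrite QE [leRHS]EFinM; apply: lee_wpmul2l; first by rewrite lee_fin powR_ge0.
rewrite EFinD; apply: leeD.
  exact: le_trans (weighted_energy_le p1 w0 u wnu) uE.
exact: le_trans (weighted_energy_le p1 w0 v wnu) vE.
Qed.

(** The constants are chosen in the order: the mass I of the weight (large), the bound
    tau for the averages, the size delta of the exceptional set, the parameter t of
    the Young inequality, and the precision eta of the cells.  Each of the three
    error terms is then at most a quarter of e^p. *)
Lemma nonintegrable_finitely_split (K : set (Rd R d)) (mK : measurable K) (M e : R) :
  ~ mu.-integrable (@punctured R d) (EFin \o nu) ->
  (mu K < +oo)%E -> 0 < e ->
  finitely_split [set u : LT | W_space nu u /\ (W_norm nu u <= M%:E)%E]
    (fun u v => ball (Lspace_restr mK u) e (Lspace_restr mK v)).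
Proof.
move=> nint Koo e0.
have quarters (a : R) : a = a / 4 + (a / 4 + a / 4) + a / 4 by field.
pose A := Num.max 0 M `^ p; pose Q := 2 `^ p * (A + A); pose eps := e `^ p.
have A0 : 0 <= A by exact: powR_ge0.
have Q0 : 0 <= Q by rewrite mulr_ge0 ?powR_ge0// addr_ge0.
have eps0 : 0 < eps by exact: powR_gt0.
have four0 : 0 < 4 `^ p :> R by exact: powR_gt0.
have two0 : 0 < 2 `^ p :> R by exact: powR_gt0.
(* A mass above L makes the energy term at most eps / 4. *)
pose L := 4 `^ p * (Q + 1) * 4 / eps.
have L0 : 0 < L by rewrite /L divr_gt0// !mulr_gt0// ltr_wpDl.
have [w [wnu woo Lw]] := borel_minorant_large nu_measurable nu_ge0 L nint.
pose I := fine (\int[mu]_h (w h)%:E)%E.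
have wI : (\int[mu]_h (w h)%:E = I%:E)%E.
  by rewrite fineK// ge0_fin_numE// integral_ge0// => h _; rewrite lee_fin.
have LI : L < I by rewrite -lte_fin -wI.
have I0 : 0 < I by exact: lt_trans LI.
have [C0 [_ /= /(_ (C0 + 1))]] := simple_bounded w; rewrite ltrDl ltr01 => /(_ isT) wC0.
pose C := C0 + 1.
have wC h : w h <= C by exact: le_trans (ler_norm _) (wC0 h _).
have Cge0 : 0 <= C by exact: le_trans (wC 0).
pose kappa := fine (mu K).
have Kk : (mu K <= kappa%:E)%E by rewrite fineK// ge0_fin_numE.
have k0 : 0 <= kappa by exact: fine_ge0.
pose c := 2 `^ p / I `^ p.
have c0 : 0 < c by rewrite divr_gt0// powR_gt0.
pose tau := (eps / (4 * c * (kappa + 1))) `^ p^-1.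
have k10 : 0 < kappa + 1 by rewrite ltr_wpDl.
have c40 : 0 < 4 * c by apply: mulr_gt0.
have arg0 : 0 < eps / (4 * c * (kappa + 1)) by apply: divr_gt0 => //; exact: mulr_gt0.
have tau0 : 0 < tau by exact: powR_gt0.
have taup : tau `^ p = eps / (4 * c * (kappa + 1)).
  by rewrite /tau -powRrM mulVf ?gt_eqF// powRr1// ltW.
pose B := I + C * Q.
have CQ0 : 0 <= C * Q by exact: mulr_ge0.
have B0 : 0 <= B by rewrite addr_ge0// ltW.
have Bp0 : 0 <= B `^ p by exact: powR_ge0.
pose delta := eps / (4 * c * (B `^ p + 1)).
have B10 : 0 < B `^ p + 1 by rewrite ltr_wpDl.
have delta0 : 0 < delta by apply: divr_gt0 => //; exact: mulr_gt0.
(* t is the solution of t^(1-p) = s; this uses p <> 1. *)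
pose s := tau / 3 / (C * Q + 1).
have CQ1 : 0 < C * Q + 1 by rewrite ltr_wpDl.
have tau30 : 0 < tau / 3 by rewrite divr_gt0.
have s0 : 0 < s by rewrite divr_gt0.
pose t := s `^ (1 - p)^-1.
have t0 : 0 < t by exact: powR_gt0.
have ts : t `^ (1 - p) = s.
  by rewrite /t -powRrM mulVf ?subr_eq0 ?lt_eqF// powRr1// ltW.
pose eta := tau / 3 / t.
have eta0 : 0 < eta by rewrite divr_gt0.
have small : t * eta + t `^ (1 - p) * (C * Q) <= tau / 3 + tau / 3.
  apply: lerD; first by rewrite /eta mulrC divfK// gt_eqF.
  rewrite ts /s -mulrA ler_piMr ?(ltW tau30)// mulrC ler_pdivrMr// mul1r.
  by rewrite lerDl.
have := bounded_scale_split I0 wI wC wnu mK Kk tau0 delta0 eta0 t0 (erefl Q) (erefl B) B0 small.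
apply: finitely_split_sub.
  move=> u [_ uM]; have M0 : 0 <= Num.max 0 M by rewrite le_max lexx.
  apply: (W_norm_bounds nu_ge0 M0); apply: le_trans uM _.
  by rewrite lee_fin le_max lexx orbT.
move=> u v _ _ uv; apply/(Lspace_restr_ballE mK u v e0); apply: le_lt_trans uv _.
rewrite lte_fin -/eps -/c.
have h1 : 4 `^ p / I * Q <= eps / 4.
  rewrite mulrAC ler_pdivrMr//.
  apply: (@le_trans _ _ (eps / 4 * L)); last by rewrite ler_wpM2l ?(ltW LI)// divr_ge0// ltW.
  have -> : eps / 4 * L = 4 `^ p * (Q + 1) by rewrite /L; field; rewrite gt_eqF.
  by rewrite ler_wpM2l ?(ltW four0)// lerDl.
have h2 : c * (B `^ p * delta) <= eps / 4.
  have -> : c * (B `^ p * delta) = eps / 4 * (B `^ p / (B `^ p + 1)).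
    by rewrite /delta; field; rewrite !gt_eqF.
  rewrite ler_piMr ?divr_ge0 ?(ltW eps0)// ler_pdivrMr// mul1r.
  by rewrite lerDl.
have h3 : c * (tau `^ p * kappa) <= eps / 4.
  have -> : c * (tau `^ p * kappa) = eps / 4 * (kappa / (kappa + 1)).
    by rewrite taup; field; rewrite !gt_eqF.
  rewrite ler_piMr ?divr_ge0 ?(ltW eps0)// ler_pdivrMr// mul1r.
  by rewrite lerDl.
rewrite mulrDr [ltRHS](quarters eps).
apply: (@le_lt_trans _ _ (eps / 4 + (eps / 4 + eps / 4))); first by apply: lerD => //; exact: lerD.
by rewrite ltrDl divr_gt0.
Qed.

End compactness_of_nonintegrable.

(** * Integrable kernels do not *)

Section integrable_kernels.
Context (R : realType) (d : nat) (p : R) (p1 : (1 <= p%:E)%E) (nu : Rd R d -> R).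
Local Notation mu := (@lebesgue_Rd R d).
Hypothesis nu_measurable : measurable_fun (@punctured R d) nu.
Hypothesis nu_ge0 : forall h : 'rV[R]_d, h != 0 -> 0 <= nu h.

Let p0 : 0 < p. Proof. by rewrite (lt_le_trans ltr01)// -lee_fin. Qed.

(** The majorant is infinite on the Borel null set where the representative may fail:
    it dominates nu everywhere, so that x - y may be substituted into it. *)
Lemma borel_majorant : exists g : borel_rV R d -> \bar R,
  [/\ measurable_fun setT g, forall h, (0 <= g h)%E,
      forall h : 'rV[R]_d, h != 0 -> ((nu h)%:E <= g h)%E &
      (\int[mu]_h g h = \int[mu]_(h in @punctured R d) (nu h)%:E)%E].
Proof.
have [g [N [mg g0 mN N0 [_ gnu gE]]]] := borel_version nu_measurable nu_ge0.
have mgE : measurable_fun setT (fun h => (g h)%:E) by exact/measurable_EFinP.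
have mN1 : measurable_fun setT (fun h => (\1_N h : R)%:E).
  by apply/measurable_EFinP; exact: measurable_indic.
have mNoo : measurable_fun setT (fun h => +oo * (\1_N h : R)%:E)%E by exact: measurable_funeM.
have g0E h : (0 <= (g h)%:E)%E by rewrite lee_fin.
have N0E h : (0 <= (\1_N h : R)%:E)%E by rewrite lee_fin.
have Noo0 h : (0 <= +oo * (\1_N h : R)%:E)%E by rewrite mule_ge0.
exists (fun h => (g h)%:E + +oo * (\1_N h)%:E)%E; split.
- exact: emeasurable_funD mgE mNoo.
- by move=> h; rewrite adde_ge0.
- move=> h h0; have [Nh|Nh] := pselect (N h).
    by rewrite indicE mem_set// mule1 leey.
  by rewrite indicE memNset// mule0 adde0 lee_fin gnu.
have mNRd : measurable (N : set (Rd R d)) by exact: caratheodory_measurable_mu_ext.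
have muN : mu N = 0%E by rewrite -[RHS]N0; exact: lebesgue_RdE.
rewrite gE (ge0_integralD mu measurableT (fun h _ => g0E h) (measurable_fun_Rd mgE)
  (fun h _ => Noo0 h) (measurable_fun_Rd mNoo)).
rewrite (ge0_integralZl mu measurableT (measurable_fun_Rd mN1) (fun h _ => N0E h) (leey 0)).
by rewrite (integral_indic mu measurableT mNRd) setIT [X in (_ * X)%E]muN mule0 adde0.
Qed.

(** Bound |f x - f y|^p by 2^p (|f x|^p + |f y|^p); each of the two terms is a
    convolution of |f|^p with an integrable function, computed by Tonelli. *)
Lemma integrable_energy_le (f : Rd R d -> R) : measurable_fun setT f ->
  (nonlocal_energy p nu f <=
    (2 `^ p * 2)%:E * ((\int[mu]_x (`|f x| `^ p)%:E) *
       \int[mu]_(h in @punctured R d) (nu h)%:E))%E.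
Proof.
move=> mf; have [g [mg g0 nug <-]] := borel_majorant.
set J := (\int[mu]_h g h)%E; set F := (\int[mu]_x (`|f x| `^ p)%:E)%E.
have k0 : 0 <= 2 `^ p :> R by exact: powR_ge0.
pose fp (x : Rd R d) : \bar R := (`|f x| `^ p)%:E.
have mfp : measurable_fun setT fp := measurable_powR_norm p mf.
have fp0 x : (0 <= fp x)%E by rewrite lee_fin powR_ge0.
have mrow (x : 'rV[R]_d) : measurable_fun setT (fun y : Rd R d => g (x - (y : 'rV[R]_d))%R).
  exact: measurable_fun_Rd (measurableT_comp mg (measurable_refl_rV x)).
pose H2 (z : Rd R d * Rd R d) : \bar R := (fp z.2 * g ((z.1 : 'rV[R]_d) - (z.2 : 'rV[R]_d))%R)%E.
have mH2 : measurable_fun setT H2.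
  apply: emeasurable_funM; first exact: (measurableT_comp mfp measurable_snd).
  exact: (measurableT_comp mg (@measurable_sub_Rd R d)).
have H20 z : (0 <= H2 z)%E by exact: mule_ge0.
pose H (x : Rd R d) : \bar R := (\int[mu]_y H2 (x, y))%E.
have mH : measurable_fun setT H := @measurable_fun_fubini_tonelli_F _ _ _ _ _ mu _ mH2 H20.
have H0 x : (0 <= H x)%E by apply: integral_ge0 => y _.
have J0 : (0 <= J)%E by apply: integral_ge0 => y _.
have HE : (\int[mu]_x H x = F * J)%E.
  rewrite /H (@fubini_tonelli _ _ _ _ _ mu mu H2 mH2 H20).
  rewrite -(ge0_integralZr mu measurableT mfp (fun x _ => fp0 x) J0).
  apply: eq_integral => y _; rewrite /H2 /=.
  have mcol : measurable_fun setT (fun x : Rd R d => g ((x : 'rV[R]_d) - (y : 'rV[R]_d))%R).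
    apply: (measurableT_comp mg).
    apply: (measurableT_comp (@measurable_sub_rV R d)
      (g := fun x : Rd R d => (x : borel_rV R d, y : borel_rV R d))).
    apply/measurable_fun_pairP; split => /=; first exact: measurable_Rd_borel.
    exact: (measurable_cst (y : borel_rV R d)).
  rewrite (ge0_integralZl mu measurableT mcol (fun x _ => g0 _) (fp0 y)).
  by rewrite (ge0_integral_translate (y : 'rV[R]_d) mg g0).
apply: (@le_trans _ _ (\int[mu]_x ((2 `^ p)%:E * (fp x * J + H x)))%E).
  apply: ge0_le_integral_lower => x.
    by apply: integral_ge0 => y _; rewrite lee_fin; exact: (energy_integrand_ge0 p1 nu_ge0 f x y).
  have f1 (y : Rd R d) : (0 <= fp x * g (x - y)%R)%E by exact: mule_ge0.
  have f2 (y : Rd R d) : (0 <= H2 (x, y))%E by exact: H20.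
  have m1 : measurable_fun setT (fun y : Rd R d => fp x * g ((x : 'rV[R]_d) - y)%R)%E.
    exact: measurable_funeM (mrow x).
  have m2 : measurable_fun setT (fun y : Rd R d => H2 (x, y)).
    exact: emeasurable_funM mfp (mrow x).
  have <- : (\int[mu]_y (fp x * g ((x : 'rV[R]_d) - (y : 'rV[R]_d))%R) = fp x * J)%E.
    rewrite (ge0_integralZl mu measurableT (mrow x) (fun y _ => g0 _) (fp0 x)).
    by rewrite (ge0_integral_refl (x : 'rV[R]_d) mg g0).
  rewrite /H -(ge0_integralZD mu k0 m1 m2 f1 f2).
  apply: ge0_le_integral_lower => y.
    by rewrite lee_fin; exact: (energy_integrand_ge0 p1 nu_ge0 f x y).
  have [xy|xy] := eqVneq (x : 'rV[R]_d) y.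
    rewrite xy subrr normr0 powR0 ?gt_eqF// mul0r.
    by apply: mule_ge0; [rewrite lee_fin|apply: adde_ge0; rewrite -?xy].
  have gxy : ((nu (x - y))%:E <= g (x - y)%R)%E by apply: nug; rewrite subr_eq0.
  rewrite EFinM /H2 /= -ge0_muleDl//.
  apply: (@le_trans _ _ ((`|f x - f y| `^ p)%:E * g (x - y)%R)%E).
    by rewrite lee_wpmul2l// lee_fin powR_ge0.
  rewrite muleA lee_wpmul2r// -EFinD -EFinM lee_fin.
  exact: powR_normB (ltW p0).
have m1 : measurable_fun setT (fun x => fp x * J)%E by exact: emeasurable_funM mfp (measurable_cst J).
have f1 x : (0 <= fp x * J)%E by exact: mule_ge0.
rewrite (ge0_integralZD mu k0 m1 mH f1 H0) HE.
rewrite (ge0_integralZr mu measurableT mfp (fun x _ => fp0 x) J0).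
rewrite EFinM -muleA lee_wpmul2l// ?lee_fin// -[X in (X + _)%E]mul1e -[X in (_ + X)%E]mul1e.
have FJ0 : (0 <= F * J)%E by apply: mule_ge0 => //; apply: integral_ge0 => x _.
by rewrite -ge0_muleDl// -EFinD.
Qed.

End integrable_kernels.

Section disjoint_bumps.
Context (R : realType) (d : nat) (p : R) (p0 : 0 < p) (d_gt0 : (0 < d)%N).
Local Notation mu := (@lebesgue_Rd R d).

Let r (n : nat) : R := d%:R^-1 * 2^-1 ^+ n.

Let r_gt0 n : 0 < r n.
Proof. by rewrite mulr_gt0 ?exprn_gt0 ?invr_gt0 ?ltr0n. Qed.

Let r_lt n : r n.+1 < r n.
Proof.
rewrite /r ltr_pM2l ?invr_gt0 ?ltr0n// exprS gtr_pMl ?exprn_gt0 ?invr_gt0//.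
by rewrite invf_lt1 ?ltr1n.
Qed.

Definition annulus n : set (Rd R d) :=
  (ball (0 : 'rV[R]_d) (r n) : set _) `\` ball (0 : 'rV[R]_d) (r n.+1).

Lemma measurable_annulus n : measurable (annulus n).
Proof. by apply: measurableD; exact: measurable_ball_Rd. Qed.

Lemma annulus_disjoint n m x : annulus n x -> annulus m x -> n = m.
Proof.
have H i j : (i < j)%N -> annulus i x -> annulus j x -> False.
  move=> ij [_ nix] [jx _]; apply: nix; apply: le_ball jx.
  elim: j ij => // j IH; rewrite ltnS leq_eqVlt => /predU1P[<-//|ij].
  by apply: le_trans (ltW (r_lt _)) (IH ij).
by move=> nx mx; have [h|h|->] := ltngtP n m; [case: (H n m)|case: (H m n)|].
Qed.

Lemma annulus_sub_eball n : annulus n `<=` @eball R d 1.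
Proof.
move=> x [xr _]; apply: (ball_sub_eball d_gt0 ltr01); apply: le_ball xr.
by rewrite mul1r /r ger_pMr ?invr_gt0 ?ltr0n// exprn_ile1 ?invr_ge0// invf_le1 ?ler1n.
Qed.

Lemma annulus_measure n : exists2 a : R, 0 < a & mu (annulus n) = a%:E.
Proof.
exists ((r n *+ 2) ^+ d - (r n.+1 *+ 2) ^+ d).
  rewrite subr_gt0 ltr_pXn2r ?nnegrE ?mulrn_wge0 ?(ltW (r_gt0 _))//.
  by rewrite ltr_pMn2r.
have mB i : measurable (ball (0 : 'rV[R]_d) (r i) : set (Rd R d)) by exact: measurable_ball_Rd.
rewrite /annulus (measureD (mB n) (mB n.+1)); last by rewrite /= lebesgue_Rd_ball// ltry.
rewrite setIidr; last by apply: le_ball; exact: ltW.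
by rewrite /= !lebesgue_Rd_ball// -EFinB.
Qed.

(** Indicators of disjoint annuli, normalized: where one of them is nonzero the other one
    vanishes, so the difference carries at least the mass of one of them. *)
Lemma separated_bumps : exists f : nat -> Rd R d -> R,
  [/\ forall n, measurable_fun setT (f n),
      forall n, (\int[mu]_x (`|f n x| `^ p)%:E = 1)%E &
      forall n m, n <> m -> (1 <= \int[mu]_(x in @eball R d 1) (`|f n x - f m x| `^ p)%:E)%E].
Proof.
have ann n : exists a : R, 0 < a /\ mu (annulus n) = a%:E.
  by have [a a0 aE] := annulus_measure n; exists a.
have [a aP] := choice ann.
pose c n : R := (a n)^-1 `^ p^-1.
have cp n : `|c n| `^ p = (a n)^-1.
  rewrite ger0_norm ?powR_ge0// /c -powRrM mulVf ?gt_eqF// powRr1// invr_ge0 ltW//.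
  exact: (aP n).1.
pose f n (x : Rd R d) : R := c n * \1_(annulus n) x.
have fin n x : annulus n x -> f n x = c n by move=> nx; rewrite /f indicE mem_set// mulr1.
have fout n x : ~ annulus n x -> f n x = 0 by move=> nx; rewrite /f indicE memNset// mulr0.
have m1 n : measurable_fun setT (fun x : Rd R d => (\1_(annulus n) x : R)%:E).
  by apply/measurable_EFinP; apply: measurable_indic; exact: measurable_annulus.
have mass n : (\int[mu]_x ((a n)^-1%:E * (\1_(annulus n) x)%:E) = 1)%E.
  have [an0 anE] := aP n.
  rewrite (ge0_integralZl mu measurableT (m1 n)); last 2 first.
  - by move=> x _; rewrite lee_fin.
  - by rewrite lee_fin invr_ge0 ltW.
  rewrite (integral_indic mu measurableT (measurable_annulus n)) setIT.
  by rewrite [X in (_ * X)%E]anE -EFinM mulVf ?gt_eqF.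
exists f; split.
- by move=> n; apply: measurable_funM; [exact: measurable_cst|apply: measurable_indic; exact: measurable_annulus].
- move=> n; rewrite -[RHS](mass n); apply: eq_integral => x _.
  have [nx|nx] := pselect (annulus n x).
    by rewrite fin// cp indicE mem_set// mule1.
  by rewrite fout// normr0 powR0 ?gt_eqF// indicE memNset// mule0.
move=> n m nm; rewrite -[leLHS](mass n) [leRHS]integral_mkcond.
apply: ge0_le_integral_lower => x.
  by rewrite mule_ge0// lee_fin invr_ge0 ltW//; exact: (aP n).1.
rewrite patchE; have [nx|nx] := pselect (annulus n x); last first.
  rewrite indicE memNset// mule0; case: ifPn => // _; by rewrite lee_fin powR_ge0.
rewrite mem_set; last exact: annulus_sub_eball nx.
rewrite indicE mem_set// mule1 (fin n)// fout ?subr0 ?cp//.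
by move=> mx; apply: nm; exact: annulus_disjoint nx mx.
Qed.

End disjoint_bumps.

Section noncompactness_of_integrable.
Context (R : realType) (d : nat) (p : R) (nu : Rd R d -> R) (p1 : (1 <= p%:E)%E).
Local Notation mu := (@lebesgue_Rd R d).
Hypothesis d_gt0 : (0 < d)%N.
Hypothesis nu_measurable : measurable_fun (@punctured R d) nu.
Hypothesis nu_ge0 : forall h : 'rV[R]_d, h != 0 -> 0 <= nu h.

Let p0 : 0 < p. Proof. by rewrite (lt_le_trans ltr01)// -lee_fin. Qed.

(** Infinitely many bumps of bounded norm cannot be distributed over finitely many
    colours without two of them, at distance at least 1, sharing a colour. *)
Lemma integrable_not_finitely_split :
  mu.-integrable (@punctured R d) (EFin \o nu) ->
  exists M : R, ~ finitely_split
    [set u : LspaceType mu p1 | W_space nu u /\ (W_norm nu u <= M%:E)%E]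
    (fun u v => ball (Lspace_restr (@eball_measurable R d 1) u) 1
                     (Lspace_restr (@eball_measurable R d 1) v)).
Proof.
move=> inu; set J := (\int[mu]_(h in @punctured R d) (nu h)%:E)%E.
have J0 : (0 <= J)%E by apply: integral_ge0 => h h0; rewrite lee_fin nu_ge0.
have Jfin : J \is a fin_num.
  by apply: integrable_fin_num => //; exact: measurable_punctured.
pose M := (1 + 2 `^ p * 2 * fine J) `^ p^-1.
have arg0 : 0 <= 1 + 2 `^ p * 2 * fine J.
  by rewrite addr_ge0// !mulr_ge0 ?powR_ge0// fine_ge0.
have Mp : M `^ p = 1 + 2 `^ p * 2 * fine J by rewrite /M -powRrM mulVf ?gt_eqF// powRr1.
exists M => -[N [c [cN cE]]].
have [f [mf f1 fsep]] := separated_bumps p0 d_gt0.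
have real n : exists v : LspaceType mu p1, (v : Rd R d -> measurableTypeR R) = f n %[ae mu].
  by apply: (Lspace_realize p1 (mf n)); rewrite f1 ltry.
have [u uf] := choice real.
have u1 n : (\int[mu]_x (`|(u n x : R)| `^ p)%:E = 1)%E.
  by rewrite -(f1 n); apply: (ae_eq_integral_powR p (measurable_Lspace (u n)) (mf n)).
have uE n : (nonlocal_energy p nu (u n) <= (2 `^ p * 2 * fine J)%:E)%E.
  apply: le_trans (integrable_energy_le p1 nu_measurable nu_ge0 (measurable_Lspace (u n))) _.
  by rewrite u1 mul1e [leRHS]EFinM fineK.
have uS n : W_space nu (u n) /\ (W_norm nu (u n) <= M%:E)%E.
  split; first by apply: le_lt_trans (uE n) _; rewrite ltry.
  apply/(W_normP nu_ge0); first exact: powR_ge0.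
  by rewrite Mp u1 EFinD leeD2l.
have [i [j [ij cij]]] : exists i j : nat, i <> j /\ c (u i) = c (u j).
  pose g (i : 'I_N.+1) : 'I_N := Ordinal (cN (u i) (uS i)).
  have /injectivePn[i [j ij gij]] : ~~ injectiveb g.
    apply/negP => /injectiveP/leq_card; by rewrite !card_ord ltnn.
  exists i, j; split; first by move=> /val_inj h; rewrite h eqxx in ij.
  exact: (congr1 val gij).
have /Lspace_restr_ballE := cE _ _ (uS i) (uS j) cij; move=> /(_ ltr01).
rewrite powR1; apply/negP; rewrite -leNgt.
apply: le_trans (fsep i j ij) _; rewrite le_eqVlt; apply/orP; left; apply/eqP.
have meq : forall v1 v2 : Rd R d -> R, measurable_fun setT v1 -> measurable_fun setT v2 ->
    measurable_fun (@eball R d 1) (fun x => (`|v1 x - v2 x| `^ p)%:E).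
  move=> v1 v2 mv1 mv2; apply: measurable_funTS.
  exact: (measurable_powR_norm p (measurable_funB mv1 mv2)).
apply: ge0_ae_eq_integral.
- exact: eball_measurable.
- exact: meq.
- exact: meq (measurable_Lspace (u i)) (measurable_Lspace (u j)).
- by move=> x _; rewrite lee_fin powR_ge0.
- by move=> x _; rewrite lee_fin powR_ge0.
apply: filterS2 (uf i) (uf j) => x /(_ I) ui /(_ I) uj _.
by rewrite -ui -uj.
Qed.

End noncompactness_of_integrable.

(** * The equivalence *)

Lemma compact_closed_ball_rV (R : realType) (n : nat) :
  compact (closed_ball (0 : 'rV[R]_n) 1).
Proof.
apply: bounded_closed_compact; last exact: closed_ball_closed.
exists 1; split => // M M1 x; rewrite closed_ballE// /closed_ball_/= sub0r normrN => x1.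
exact: le_trans x1 (ltW M1).
Qed.

(** The two restrictions land in different spaces; total boundedness, unlike
    compactness, is transferred directly by comparing the distances. *)
Lemma compact_operator_restr_sub d (T : measurableType d) (R : realType)
    (mu : {measure set T -> \bar R}) (p : R) (p1 : (1 <= p%:E)%E)
    (K L : set T) (mK : measurable K) (mL : measurable L)
    (S : set (LspaceType mu p1)) : L `<=` K ->
  precompact (Lspace_restr mK (p1 := p1) @` S) ->
  precompact (Lspace_restr mL (p1 := p1) @` S).
Proof.
move=> LK cK; apply: finitely_split_precompact; first exact: Lspace_rapidly_complete.
move=> e e0; apply: finitely_split_sub (precompact_finitely_split e0 cK) => // u v _ _.
move=> /(Lspace_restr_ballE mK u v e0) h; apply/(Lspace_restr_ballE mL u v e0).
have mf : measurable_fun setT (fun x => (`|(u x : R) - v x| `^ p)%:E).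
  apply: measurable_powR_norm.
  exact: (measurable_funB (measurable_Lspace u) (measurable_Lspace v)).
apply: le_lt_trans h; apply: ge0_subset_integral => //; exact: (measurable_funTS mf).
Qed.

Unset Implicit Arguments.

Theorem theorem6p2 (R : realType) (d : nat) (p : R) (nu : Rd R d -> R)
  (d_gt0 : (0 < d)%N) (p_gt1 : 1 < p)
  (nu_measurable : measurable_fun (@punctured R d) nu)
  (nu_ge0 : forall h : 'rV[R]_d, h != 0 -> 0 <= nu h)
  (nu_sym : forall h : 'rV[R]_d, h != 0 -> nu (- h) = nu h)
  (nu_Levy : (\int[@lebesgue_Rd R d]_(h in @punctured R d)
      (Num.min 1 (enorm h `^ p) * nu h)%:E < +oo)%E) :
  [<-> ~ (@lebesgue_Rd R d).-integrable (@punctured R d) (EFin \o nu);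
       forall (K : set (Rd R d)) (mK : measurable K),
         (lebesgue_Rd K < +oo)%E ->
         compact_embedding (gt1_ge1e p_gt1) nu mK;
       compact_embedding_loc (gt1_ge1e p_gt1) nu;
       compact_embedding (gt1_ge1e p_gt1) nu (@eball_measurable R d 1)].
Proof.
tfae.
- move=> nint K mK Koo M; apply: finitely_split_precompact; first exact: Lspace_rapidly_complete.
  by move=> e e0; exact: nonintegrable_finitely_split.
- by move=> emb K cK; apply: emb; exact: compact_lebesgue_Rd_lty.
- move=> emb M.
  apply: (compact_operator_restr_sub _ (@eball1_sub_ball R d) (emb _ (@compact_closed_ball_rV R d) M)).
move=> emb inu.
have [M nsplit] := integrable_not_finitely_split (gt1_ge1e p_gt1) d_gt0 nu_measurable nu_ge0 inu.
by apply: nsplit; exact: (precompact_finitely_split ltr01 (emb M)).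
Qed.
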